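(* Suppose $0<\boldsymbol{\pi}_r^\top\mathrm{diag}(\boldsymbol{\alpha})\boldsymbol{\pi}_c<\frac{2}{nl}$. Then the following inequality holds entry-wise for all $k\ge 0$: $$\mathbf{t}_{k+1}\le J_{\boldsymbol{\alpha},\overline{\beta}}\,\mathbf{t}_k,$$ where $$\mathbf{t}_k=\begin{bmatrix}\|\mathbf{x}_k-\mathcal{A}_\infty\mathbf{x}_k\|_{\mathcal{A}}\\ \|\mathcal{A}_\infty\mathbf{x}_k-\mathbf{1}_n\otimes\mathbf{x}^*\|\\ \|\mathbf{x}_k-\mathbf{x}_{k-1}\|\\ \|\mathbf{y}_k-\mathcal{B}_\infty\mathbf{y}_k\|_{\mathcal{B}}\end{bmatrix},\qquad J_{\boldsymbol{\alpha},\overline{\beta}}=\begin{bmatrix}\sigma_{\mathcal{A}}+a_1\overline{\alpha}&a_2\overline{\alpha}&\overline{\beta}a_3&a_4\overline{\alpha}\\ a_5\overline{\alpha}&\lambda&\overline{\beta}a_6&a_7\overline{\alpha}\\ a_8+a_9\overline{\alpha}&a_{10}\overline{\alpha}&\overline{\beta}&a_{11}\overline{\alpha}\\ a_{12}+a_{13}\overline{\alpha}&a_{14}\overline{\alpha}&\overline{\beta}a_{15}&\sigma_{\mathcal{B}}+a_{16}\overline{\alpha}\end{bmatrix},$$ $\lambda=\max\{|1-\mu n\boldsymbol{\pi}_r^\top\mathrm{diag}(\boldsymbol{\alpha})\boldsymbol{\pi}_c|,\ |1-ln\boldsymbol{\pi}_r^\top\mathrm{diag}(\boldsymbol{\alpha})\boldsymbol{\pi}_c|\}$,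 and the constants are $a_1=c_{\mathcal{A}2}c_{2\mathcal{A}}\overline{l}\,\|I_{np}-\mathcal{A}_\infty\|\|\mathcal{B}_\infty\|$, $a_2=c_{\mathcal{A}2}\overline{l}\,\|I_{np}-\mathcal{A}_\infty\|\|\mathcal{B}_\infty\|$, $a_3=c_{\mathcal{A}2}\|I_{np}-\mathcal{A}_\infty\|$, $a_4=c_{\mathcal{A}2}c_{2\mathcal{B}}\|I_{np}-\mathcal{A}_\infty\|$, $a_5=nc_{2\mathcal{A}}(\boldsymbol{\pi}_r^\top\boldsymbol{\pi}_c)\overline{l}$, $a_6=\|\mathcal{A}_\infty\|$, $a_7=c_{2\mathcal{B}}\|\mathcal{A}_\infty\|$, $a_8=c_{2\mathcal{A}}\|\mathcal{A}-I_{np}\|$, $a_9=c_{2\mathcal{A}}\overline{l}\,\|\mathcal{B}_\infty\|$, $a_{10}=\overline{l}\,\|\mathcal{B}_\infty\|$, $a_{11}=c_{2\mathcal{B}}$, $a_{12}=c_{\mathcal{B}2}c_{2\mathcal{A}}\overline{l}\,\|I_{np}-\mathcal{B}_\infty\|\|\mathcal{A}-I_{np}\|$, $a_{13}=c_{\mathcal{B}2}c_{2\mathcal{A}}\overline{l}^2\|I_{np}-\mathcal{B}_\infty\|\|\mathcal{B}_\infty\|$, $a_{14}=c_{\mathcal{B}2}\overline{l}^2\|I_{np}-\mathcal{B}_\infty\|\|\mathcal{B}_\infty\|$, $a_{15}=c_{\mathcal{B}2}\overline{l}\,\|I_{np}-\mathcal{B}_\infty\|$, $a_{16}=c_{\mathcal{B}2}c_{2\mathcal{B}}\overline{l}\,\|I_{np}-\mathcal{B}_\infty\|$.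 Moreover, let $\delta_1,\delta_2,\delta_3,\delta_4$ be arbitrary constants such that $$0<\delta_1<\min\left\{\frac{\delta_3}{a_8},\frac{(1-\sigma_{\mathcal{B}})\delta_4}{a_{12}}\right\},\quad \delta_2>\frac{a_5\delta_1+a_7\delta_4}{\mu[\boldsymbol{\pi}_r]_{\min}[\boldsymbol{\pi}_c]_{\min}},\quad \delta_3>0,\quad \delta_4>0.$$ If the largest step-size $\overline{\alpha}$ satisfies $$0<\overline{\alpha}<\min\left\{\frac{1}{nl\boldsymbol{\pi}_r^\top\boldsymbol{\pi}_c},\ \frac{\delta_1(1-\sigma_{\mathcal{A}})}{a_1\delta_1+a_2\delta_2+a_4\delta_4},\ \frac{\delta_3-\delta_1a_8}{a_9\delta_1+a_{10}\delta_2+a_{11}\delta_4},\ \frac{(1-\sigma_{\mathcal{B}})\delta_4-\delta_1a_{12}}{a_{13}\delta_1+a_{14}\delta_2+a_{16}\delta_4}\right\}$$ and the largest momentum parameter $\overline{\beta}$ satisfies $$0\le\overline{\beta}<\min\Bigg\{\frac{\delta_1(1-\sigma_{\mathcal{A}})-(a_1\delta_1+a_2\delta_2+a_4\delta_4)\overline{\alpha}}{a_3\delta_3},\ \frac{\big(\delta_2\mu[\boldsymbol{\pi}_r]_{\min}[\boldsymbol{\pi}_c]_{\min}-(a_5\delta_1+a_7\delta_4)\big)\overline{\alpha}}{a_6\delta_3},$$ $$\frac{\delta_3-\delta_1a_8-(a_9\delta_1+a_{10}\delta_2+a_{11}\delta_4)\overline{\alpha}}{\delta_3},\ \frac{(1-\sigma_{\mathcal{B}})\delta_4-\delta_1a_{12}-(a_{13}\delta_1+a_{14}\delta_2+a_{16}\delta_4)\overline{\alpha}}{a_{15}\delta_3}\Bigg\},$$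 then $\rho(J_{\boldsymbol{\alpha},\overline{\beta}})<1$, and thus $\|\mathbf{x}_k-\mathbf{1}_n\otimes\mathbf{x}^*\|$ converges to zero linearly at the rate $\mathcal{O}\big(\rho(J_{\boldsymbol{\alpha},\overline{\beta}})^k\big)$.
   Context: Graph and weights. $\mathcal{G}=(\mathcal{V},\mathcal{E})$, $\mathcal{V}=\{1,\dots,n\}$, is a strongly-connected directed graph; $(i,j)\in\mathcal{E}$ means agent $j$ can send information to agent $i$. $\mathcal{N}_i^{\rm in}$ (resp. $\mathcal{N}_i^{\rm out}$) is the set of agents that can send information to (resp. receive information from) agent $i$; both include $i$ itself. $A=\{a_{ij}\}$ is row-stochastic ($\sum_j a_{ij}=1$ for all $i$) with $a_{ij}>0$ if $j\in\mathcal{N}_i^{\rm in}$ and $a_{ij}=0$ otherwise; $B=\{b_{ij}\}$ is column-stochastic ($\sum_i b_{ij}=1$ for all $j$) with $b_{ij}>0$ if $i\in\mathcal{N}_j^{\rm out}$ and $b_{ij}=0$ otherwise. $\boldsymbol{\pi}_r$ is the left eigenvector of $A$ for eigenvalue $1$ with $\boldsymbol{\pi}_r^\top\mathbf{1}_n=1$; $\boldsymbol{\pi}_c$ is the right eigenvector of $B$ for eigenvalue $1$ with $\mathbf{1}_n^\top\boldsymbol{\pi}_c=1$. $\mathbf{1}_n$ is the all-ones vector. $\mathcal{A}=A\otimes I_p$, $\mathcal{B}=B\otimes I_p$, $\mathcal{A}_\infty=\lim_k\mathcal{A}^k=(\mathbf{1}_n\boldsymbol{\pi}_r^\top)\otimes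 I_p$, $\mathcal{B}_\infty=\lim_k\mathcal{B}^k=(\boldsymbol{\pi}_c\mathbf{1}_n^\top)\otimes I_p$. Objectives. $F=\frac1n\sum_{i=1}^n f_i$ with differentiable $f_i:\mathbb{R}^p\to\mathbb{R}$. Each $f_i$ satisfies $f_i(\mathbf{y})\ge f_i(\mathbf{x})+\nabla f_i(\mathbf{x})^\top(\mathbf{y}-\mathbf{x})+\frac{\mu_i}{2}\|\mathbf{x}-\mathbf{y}\|^2$ for all $\mathbf{x},\mathbf{y}\in\mathbb{R}^p$, where $\mu_i\ge0$ and $\sum_i\mu_i>0$, and $\|\nabla f_i(\mathbf{x})-\nabla f_i(\mathbf{y})\|\le l_i\|\mathbf{x}-\mathbf{y}\|$ for all $\mathbf{x},\mathbf{y}$, with $l_i>0$. Put $\mu=\frac1n\sum_i\mu_i$, $l=\frac1n\sum_i l_i$, $\overline{l}=\max_i l_i$. $\mathbf{x}^*\in\mathbb{R}^p$ is the unique minimizer of $F$. The $\mathcal{AB}m$ algorithm. Agent $i$ has step-size $\alpha_i\ge0$ and momentum parameter $\beta_i\ge0$; $\boldsymbol{\alpha},\boldsymbol{\beta}\in\mathbb{R}^n$ are the corresponding vectors, $D_{\boldsymbol\alpha}=\mathrm{diag}(\boldsymbol\alpha)\otimes I_p$, $D_{\boldsymbol\beta}=\mathrm{diag}(\boldsymbol\beta)\otimes I_p$, $\overline{\alpha}=\max_i\alpha_i$, $\overline{\beta}=\max_i\beta_i$. With $\mathbf{x}_k,\mathbf{y}_k\in\mathbb{R}^{np}$ the stacked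 vectors of $\mathbf{x}_k^i,\mathbf{y}_k^i\in\mathbb{R}^p$, and $\nabla\mathbf{f}(\mathbf{x}_k)$ the stacked vector of $\nabla f_i(\mathbf{x}_k^i)$, the iteration for $k\ge0$ is $$\mathbf{x}_{k+1}=\mathcal{A}\mathbf{x}_k-D_{\boldsymbol\alpha}\mathbf{y}_k+D_{\boldsymbol\beta}(\mathbf{x}_k-\mathbf{x}_{k-1}),\qquad \mathbf{y}_{k+1}=\mathcal{B}\mathbf{y}_k+\nabla\mathbf{f}(\mathbf{x}_{k+1})-\nabla\mathbf{f}(\mathbf{x}_k),$$ with $\mathbf{x}_0$ arbitrary, $\mathbf{x}_{-1}=\mathbf{0}$, $\mathbf{y}_0=\nabla\mathbf{f}(\mathbf{x}_0)$. Norms. $\|\cdot\|$ is the Euclidean vector norm and its induced matrix norm. $\|\cdot\|_{\mathcal{A}}$ and $\|\cdot\|_{\mathcal{B}}$ are fixed vector norms on $\mathbb{R}^{np}$ (known to exist) for which there are constants $\sigma_{\mathcal{A}},\sigma_{\mathcal{B}}\in(0,1)$ with $\|\mathcal{A}\mathbf{x}-\mathcal{A}_\infty\mathbf{x}\|_{\mathcal{A}}\le\sigma_{\mathcal{A}}\|\mathbf{x}-\mathcal{A}_\infty\mathbf{x}\|_{\mathcal{A}}$ and $\|\mathcal{B}\mathbf{x}-\mathcal{B}_\infty\mathbf{x}\|_{\mathcal{B}}\le\sigma_{\mathcal{B}}\|\mathbf{x}-\mathcal{B}_\infty\mathbf{x}\|_{\mathcal{B}}$ for all $\mathbf{x}\in\mathbb{R}^{np}$.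 The positive constants $c_{2\mathcal{A}},c_{\mathcal{A}2},c_{2\mathcal{B}},c_{\mathcal{B}2}$ satisfy $\|\cdot\|\le c_{2\mathcal{A}}\|\cdot\|_{\mathcal{A}}$, $\|\cdot\|_{\mathcal{A}}\le c_{\mathcal{A}2}\|\cdot\|$, $\|\cdot\|\le c_{2\mathcal{B}}\|\cdot\|_{\mathcal{B}}$, $\|\cdot\|_{\mathcal{B}}\le c_{\mathcal{B}2}\|\cdot\|$. Other notation. $[\mathbf{v}]_{\min}$ is the smallest entry of a vector $\mathbf{v}$; $\rho(\cdot)$ is the spectral radius. *)

(* Defs.v *)
From HB Require Import structures.
From mathcomp Require Import all_boot all_order all_algebra.
From mathcomp Require Import mxtens complex.
From mathcomp Require Import all_classical all_reals all_analysis.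

Set Implicit Arguments.
Unset Strict Implicit.
Unset Printing Implicit Defensive.

Import Order.TTheory GRing.Theory Num.Theory.
Import numFieldNormedType.Exports.

Local Open Scope classical_set_scope.
Local Open Scope ring_scope.

Section Norms.
Variable R : realType.

(* The Euclidean norm; the norm [`|v|] that the library puts on matrices is the
   sup norm. *)
Definition enorm (m : nat) (v : 'cV[R]_m) : R :=
  Num.sqrt (\sum_(i < m) v i 0 ^+ 2).

Definition opnorm (m n : nat) (M : 'M[R]_(m, n)) : R :=
  sup [set enorm (M *m v) | v in [set v : 'cV[R]_n | enorm v <= 1]].

Definition is_norm (m : nat) (N : 'cV[R]_m -> R) : Prop :=
  [/\ forall u v, N (u + v) <= N u + N v,
      forall (a : R) v, N (a *: v) = `|a| * N v
    & forall v, N v = 0 -> v = 0].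

Definition spectral_radius (m : nat) (M : 'M[R]_m) : R :=
  sup [set Normc.normc z | z in
        [set z : R[i] | eigenvalue (map_mx (real_complex R) M) z]].

End Norms.

Section Entries.
Variable R : realType.

(* Only used for non-negative entries, hence the default value 0. *)
Definition vmax (n : nat) (v : 'cV[R]_n) : R :=
  \big[Order.max/0]_(i < n) v i 0.

Definition vmin (n : nat) (v : 'cV[R]_n) : R :=
  inf [set v i 0 | i in [set: 'I_n]].

Definition mx_of_rows (m n : nat) (rows : seq (seq R)) : 'M[R]_(m, n) :=
  \matrix_(i, j) nth 0 (nth [::] rows i) j.

Definition col_of_seq (m : nat) (s : seq R) : 'cV[R]_m := \col_i nth 0 s i.

(* The inverse of 0 in [\bar R] is +oo, so a bound whose denominator vanishes
   and whose numerator is positive is void.  This happens for n = 1, where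
   A = A_infty = B_infty = I. *)
Definition equot (x y : R) : \bar R := (x%:E / y%:E)%E.

End Entries.

Section Network.
Variables (R : realType) (n : nat).

Definition strongly_connected (E : rel 'I_n) : Prop :=
  forall i j, connect E i j.

(* [E i j] means that agent j can send information to agent i. *)
Definition N_in (E : rel 'I_n) (i : 'I_n) : {set 'I_n} :=
  [set j | (j == i) || E i j].

Definition N_out (E : rel 'I_n) (i : 'I_n) : {set 'I_n} :=
  [set j | (j == i) || E j i].

Definition row_stochastic_weights (E : rel 'I_n) (A : 'M[R]_n) : Prop :=
  [/\ forall i, \sum_j A i j = 1,
      forall i j, j \in N_in E i -> 0 < A i j
    & forall i j, j \notin N_in E i -> A i j = 0].

Definition column_stochastic_weights (E : rel 'I_n) (B : 'M[R]_n) : Prop :=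
  [/\ forall j, \sum_i B i j = 1,
      forall i j, i \in N_out E j -> 0 < B i j
    & forall i j, i \notin N_out E j -> B i j = 0].

Definition ones : 'cV[R]_n := const_mx 1.

End Network.

Arguments ones {R n}.

Section Stacked.
Variables (R : realType) (n p : nat).

Definition kronI (M : 'M[R]_n) : 'M[R]_(n * p) := M *t (1%:M : 'M[R]_p).

Definition kronD (a : 'cV[R]_n) : 'M[R]_(n * p) := kronI (diag_mx a^T).

Definition lim_pow (m : nat) (M : 'M[R]_m) : 'M[R]_m :=
  lim (M ^+ k @[k --> \oo]).

(* 1_n (x) z; the Kronecker product has 1 * 1 columns. *)
Definition rep (z : 'cV[R]_p) : 'cV[R]_(n * p) := (ones : 'cV[R]_n) *t z.

Definition block (x : 'cV[R]_(n * p)) (i : 'I_n) : 'cV[R]_p :=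
  \col_j x (mxtens_index (i, j)) 0.

Definition stack (v : 'I_n -> 'cV[R]_p) : 'cV[R]_(n * p) :=
  \col_k v (mxtens_unindex k).1 (mxtens_unindex k).2 0.

End Stacked.

Section Objectives.
Variables (R : realType) (n p : nat).

Definition grad (g : 'cV[R]_p -> R) (x : 'cV[R]_p) : 'cV[R]_p :=
  \col_j 'D_(delta_mx j 0) g x.

Definition strongly_convex (m : R) (g : 'cV[R]_p -> R) : Prop :=
  forall x y, g x + ((grad g x)^T *m (y - x)) 0 0
                + m / 2 * enorm (x - y) ^+ 2 <= g y.

Definition smooth (L : R) (g : 'cV[R]_p -> R) : Prop :=
  forall x y, enorm (grad g x - grad g y) <= L * enorm (x - y).

Definition average (f : 'I_n -> 'cV[R]_p -> R) (x : 'cV[R]_p) : R :=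
  n%:R^-1 * \sum_(i < n) f i x.

Definition unique_minimizer (g : 'cV[R]_p -> R) (z : 'cV[R]_p) : Prop :=
  (forall y, g z <= g y) /\
  (forall w, (forall y, g w <= g y) -> w = z).

Definition grad_stack (f : 'I_n -> 'cV[R]_p -> R) (x : 'cV[R]_(n * p))
    : 'cV[R]_(n * p) :=
  stack (fun i => grad (f i) (block x i)).

(* x_{k-1}, with x_{-1} = 0. *)
Definition prev_iter (m : nat) (x : nat -> 'cV[R]_m) (k : nat) : 'cV[R]_m :=
  if k is k'.+1 then x k' else 0.

Definition ABm (A B : 'M[R]_n) (alpha beta : 'cV[R]_n)
    (f : 'I_n -> 'cV[R]_p -> R) (x y : nat -> 'cV[R]_(n * p)) : Prop :=
  [/\ y 0%N = grad_stack f (x 0%N),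
      forall k, x k.+1 = kronI p A *m x k - kronD p alpha *m y k
                         + kronD p beta *m (x k - prev_iter x k)
    & forall k, y k.+1 = kronI p B *m y k
                         + grad_stack f (x k.+1) - grad_stack f (x k)].

End Objectives.

(* Main.v *)
Require Import Defs.
From HB Require Import structures.
From mathcomp Require Import all_boot all_order all_algebra.
From mathcomp Require Import mxtens complex.
From mathcomp Require Import all_classical all_reals all_analysis.
From mathcomp Require Import ring lra.

Set Implicit Arguments.
Unset Strict Implicit.
Unset Printing Implicit Defensive.

Import Order.TTheory GRing.Theory Num.Theory.
Import numFieldNormedType.Exports.

Local Open Scope classical_set_scope.
Local Open Scope ring_scope.

(** Write [Ainf] and [Binf] for the limits of the powers of [A] and [B] (tensored
with the identity).  Each error in [t k] is propagated by one step of the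
algorithm through a triangle inequality, and this gives the four rows of [J].

- The limits are the projections [1 pir^T] and [pic 1^T]
  ([stochastic_pow_limit]): the columns of the limit are fixed by [A], hence
  constant by the maximum principle on a strongly connected graph, and [pir] is
  preserved.  That the limit exists at all follows from the contraction
  hypothesis ([contraction_lim_pow]).  The entries of [pir] and [pic] are
  positive, since a state without mass is entered only from states without
  mass.
- Because [B] preserves sums, [Binf y k = Binf (grad f) (x k)]
  ([Binf_tracking]).  The averaged iterate thus performs a gradient step of
  length [eta = n pir^T diag(alpha) pic] on the average objective, up to three
  error terms.  Such a step contracts the distance to the minimizer by the
  factor [lambda] ([gradient_step_contraction]): co-coercivity places the
  gradient in the ball with diameter [mu d, l d], where [d] is the vector to
  [x] from the minimizer, and the triangle inequality does the rest
  ([opt_step]).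
- The other three rows ([consA_step], [mom_step], [consB_step]) use the
  contractions of [A] and [B] and the Lipschitz bound.

The conditions on the step-sizes and the momentum parameters give
[J delta < delta] for the positive vector [delta], since [lambda] is at most
[1 - mu eta] and [eta] is bounded from below by the product of the largest
step-size with the smallest entries of [pir] and [pic].  For a non-negative
matrix this forces every eigenvalue to have modulus less than 1
([spectral_radius_lt1]).

The rate [rho(J) ^ k] itself, without a polynomial factor, comes from a positive
eigenvector of [J].  With at least two agents each column of [J] is
positive, except that the third one vanishes if there is no momentum; Perron's
theorem holds for such matrices ([perron], by maximizing the Collatz-Wielandt
quotient over a compact set), and [t k] is dominated by a multiple of
[rho(J) ^ k] times the eigenvector ([geometric_bound]).  With a single agent the
two disagreement errors vanish identically, and the argument applies to the
middle two by two block of [J], whose eigenvector extends by zeros. *)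

(** * Euclidean geometry of column vectors *)

Section VectorNorms.
Variables (R : realType) (m : nat).
Implicit Types (u v w : 'cV[R]_m) (N : 'cV[R]_m -> R).

Lemma is_norm_triangle N u v : is_norm N -> N (u + v) <= N u + N v.
Proof. by case. Qed.

Lemma is_normZ N a v : is_norm N -> N (a *: v) = `|a| * N v.
Proof. by case. Qed.

Lemma is_norm0 N : is_norm N -> N 0 = 0.
Proof. by move=> NN; rewrite -(scale0r 0) is_normZ// normr0 mul0r. Qed.

Lemma is_normN N v : is_norm N -> N (- v) = N v.
Proof. by move=> NN; rewrite -scaleN1r is_normZ// normrN1 mul1r. Qed.

Lemma is_normB N u v : is_norm N -> N (u - v) <= N u + N v.
Proof. by move=> NN; rewrite -[N v]is_normN//; exact: is_norm_triangle. Qed.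

Lemma is_norm_ge0 N v : is_norm N -> 0 <= N v.
Proof.
by move=> NN; have := is_normB v v NN; rewrite subrr is_norm0//; lra.
Qed.

Definition dot u v : R := (u^T *m v) 0 0.

Lemma dotE u v : dot u v = \sum_i u i 0 * v i 0.
Proof. by rewrite /dot mxE; apply: eq_bigr => i _; rewrite mxE. Qed.

Lemma dotC u v : dot u v = dot v u.
Proof. by rewrite !dotE; apply: eq_bigr => i _; rewrite mulrC. Qed.

Lemma dotDl u v w : dot (u + v) w = dot u w + dot v w.
Proof. by rewrite /dot linearD mulmxDl mxE. Qed.

Lemma dotDr u v w : dot w (u + v) = dot w u + dot w v.
Proof. by rewrite /dot mulmxDr mxE. Qed.

Lemma dotZl a u v : dot (a *: u) v = a * dot u v.
Proof. by rewrite /dot linearZ -scalemxAl mxE. Qed.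

Lemma dotZr a u v : dot u (a *: v) = a * dot u v.
Proof. by rewrite /dot -scalemxAr mxE. Qed.

Lemma dotNl u v : dot (- u) v = - dot u v.
Proof. by rewrite -scaleN1r dotZl mulN1r. Qed.

Lemma dotNr u v : dot u (- v) = - dot u v.
Proof. by rewrite -scaleN1r dotZr mulN1r. Qed.

Lemma dotBl u v w : dot (u - v) w = dot u w - dot v w.
Proof. by rewrite dotDl dotNl. Qed.

Definition dot_lin := (dotDl, dotDr, dotNl, dotNr, dotZl, dotZr).

Lemma sqr_enorm u : enorm u ^+ 2 = dot u u.
Proof.
rewrite /enorm sqr_sqrtr ?dotE; first by apply: eq_bigr => i _; rewrite expr2.
by apply: sumr_ge0 => i _; exact: sqr_ge0.
Qed.

Lemma enorm_ge0 u : 0 <= enorm u. Proof. exact: sqrtr_ge0. Qed.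

Lemma dot_ge0 u : 0 <= dot u u.
Proof. by rewrite -sqr_enorm sqr_ge0. Qed.

Lemma enormZ a u : enorm (a *: u) = `|a| * enorm u.
Proof.
rewrite /enorm -sqrtr_sqr -sqrtrM ?sqr_ge0// mulr_sumr.
by congr (Num.sqrt _); apply: eq_bigr => i _; rewrite mxE exprMn.
Qed.

Lemma enorm_eq0 u : enorm u = 0 -> u = 0.
Proof.
move=> u0; have := sqr_enorm u; rewrite u0 expr0n dotE /= => /esym/eqP.
rewrite psumr_eq0 => [|i _]; last by rewrite -expr2 sqr_ge0.
move=> /allP h; apply/colP => i; rewrite mxE.
by have := h i (mem_index_enum _); rewrite mulf_eq0 orbb => /eqP.
Qed.

(** Cauchy-Schwarz, from the square of [|v| u - |u| v]. *)
Lemma dot_le_enorm u v : dot u v <= enorm u * enorm v.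
Proof.
have [u0|u0] := eqVneq (enorm u) 0.
  by rewrite u0 mul0r (enorm_eq0 u0) -(scale0r 0) dotZl mul0r.
have [v0|v0] := eqVneq (enorm v) 0.
  by rewrite v0 mulr0 (enorm_eq0 v0) -(scale0r 0) dotZr mul0r.
have := dot_ge0 (enorm v *: u - enorm u *: v).
rewrite !dot_lin -!sqr_enorm (dotC v u).
have : 0 < enorm u * enorm v.
  by rewrite mulr_gt0// lt_neqAle eq_sym ?u0 ?v0 enorm_ge0.
by nra.
Qed.

Lemma enorm_is_norm : is_norm (@enorm R m).
Proof.
split; [|exact: enormZ|exact: enorm_eq0] => u v.
rewrite -ler_sqr ?nnegrE ?addr_ge0 ?enorm_ge0// sqrrD !sqr_enorm !dot_lin.
by have := dot_le_enorm u v; rewrite (dotC v u); lra.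
Qed.

Lemma enorm_sum I (r : seq I) (P : pred I) (F : I -> 'cV[R]_m) :
  enorm (\sum_(i <- r | P i) F i) <= \sum_(i <- r | P i) enorm (F i).
Proof.
apply: (big_ind2 (fun u a => enorm u <= a)) => //.
  by rewrite is_norm0//; exact: enorm_is_norm.
move=> u a v b ua vb; apply: le_trans (lerD ua vb).
exact: is_norm_triangle enorm_is_norm.
Qed.

End VectorNorms.

Lemma entry_le_enorm (R : realType) m (u : 'cV[R]_m) i : `|u i 0| <= enorm u.
Proof.
rewrite /enorm -sqrtr_sqr ler_sqrt; last first.
  by apply: sumr_ge0 => j _; exact: sqr_ge0.
by rewrite (bigD1 i)//= lerDl sumr_ge0// => j _; exact: sqr_ge0.
Qed.

Section OperatorNorm.
Variables (R : realType) (m n : nat).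
Implicit Types (M : 'M[R]_(m, n)).

Let image_ball M := [set enorm (M *m v) | v in [set v : 'cV[R]_n | enorm v <= 1]].

Lemma has_sup_image_ball M : has_sup (image_ball M).
Proof.
split.
  by exists (enorm (M *m 0)); exists 0; rewrite //= is_norm0 ?ler01//;
     exact: enorm_is_norm.
exists (\sum_j enorm (col j M)) => _ [v /= v1 <-].
have -> : M *m v = \sum_j v j 0 *: col j M.
  apply/colP => i; rewrite mxE summxE; apply: eq_bigr => j _.
  by rewrite !mxE mulrC.
apply: (le_trans (enorm_sum _ _ _)); apply: ler_sum => j _.
rewrite enormZ ler_piMl ?enorm_ge0//.
exact: le_trans (entry_le_enorm _ _) v1.
Qed.

Lemma opnorm_ge0 M : 0 <= opnorm M.
Proof.
apply: le_trans (enorm_ge0 (M *m 0)) _.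
apply: (sup_upper_bound (has_sup_image_ball M)); exists 0 => //=.
by rewrite is_norm0 ?ler01//; exact: enorm_is_norm.
Qed.

Lemma enorm_mulmx M v : enorm (M *m v) <= opnorm M * enorm v.
Proof.
have [v0|v0] := eqVneq (enorm v) 0.
  by rewrite v0 (enorm_eq0 v0) mulmx0 is_norm0 ?mulr0//; exact: enorm_is_norm.
have v_gt0 : 0 < enorm v by rewrite lt_neqAle eq_sym v0 enorm_ge0.
rewrite -ler_pdivrMr// mulrC -[_^-1]ger0_norm ?invr_ge0 ?enorm_ge0//.
rewrite -enormZ scalemxAr; apply: (sup_upper_bound (has_sup_image_ball M)).
exists ((enorm v)^-1 *: v) => //=.
by rewrite enormZ ger0_norm ?invr_ge0 ?enorm_ge0// mulVf.
Qed.

Lemma opnorm_gt0 M : M != 0 -> 0 < opnorm M.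
Proof.
apply: contraTT; rewrite -leNgt => M0; rewrite negbK; apply/eqP/matrixP => i j.
have := enorm_mulmx M (delta_mx j 0); rewrite -colE.
have : opnorm M * enorm (delta_mx j 0 : 'cV[R]_n) <= 0.
  by rewrite mulr_le0_ge0// enorm_ge0.
move=> h1 h2; have := entry_le_enorm (col j M) i; rewrite !mxE => h3.
by apply/eqP; rewrite -normr_le0; lra.
Qed.

Lemma opnorm0 : opnorm (0 : 'M[R]_(m, n)) = 0.
Proof.
apply/eqP; rewrite eq_le opnorm_ge0 andbT; apply: ge_sup.
  exact: (has_sup_image_ball 0).1.
by move=> _ [v _ <-]; rewrite mul0mx is_norm0//; exact: enorm_is_norm.
Qed.

End OperatorNorm.

(** * Smooth strongly convex functions *)

Section SmoothStronglyConvex.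
Variables (R : realType) (p : nat).
Variables (F : 'cV[R]_p -> R) (G : 'cV[R]_p -> 'cV[R]_p) (mu l : R).
Hypothesis F_lower :
  forall x y, F x + dot (G x) (y - x) + mu / 2 * enorm (x - y) ^+ 2 <= F y.
Hypothesis G_lip : forall x y, enorm (G x - G y) <= l * enorm (x - y).
Hypothesis mu_ge0 : 0 <= mu.

Let dot_lip x y v : dot (G x - G y) v <= l * enorm (x - y) * enorm v.
Proof.
apply: (le_trans (dot_le_enorm _ _)).
by rewrite ler_wpM2r ?enorm_ge0.
Qed.

(** The descent lemma without integration.  Comparing the two tangents at the
endpoints gives the bound with the constant [l] in place of [l / 2]; using the
bound on both halves of the segment halves the excess over [l / 2]. *)
Let quadratic_upper_bound_approx k x y :
  F y <= F x + dot (G x) (y - x) + (1 + 2^-1 ^+ k) * (l / 2 * enorm (x - y) ^+ 2).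
Proof.
have enormC (u v : 'cV[R]_p) : enorm (u - v) = enorm (v - u).
  by rewrite -opprB is_normN//; exact: enorm_is_norm.
elim: k x y => [|k IH] x y.
  have := F_lower y x; have := dot_lip y x (y - x).
  rewrite (enormC y x) expr0 dotBl.
  have -> : dot (G y) (x - y) = - dot (G y) (y - x) by rewrite -dotNr opprB.
  have : 0 <= mu / 2 * enorm (x - y) ^+ 2.
    by rewrite mulr_ge0 ?sqr_ge0// divr_ge0.
  lra.
set z := 2^-1 *: (x + y).
have zx : z - x = 2^-1 *: (y - x).
  by apply/colP => i; rewrite !mxE; lra.
have yz : y - z = 2^-1 *: (y - x).
  by apply/colP => i; rewrite !mxE; lra.
have := IH x z; have := IH z y; have := dot_lip z x (y - x).
rewrite (enormC x z) (enormC z y) zx yz (enormC x y) !enormZ !dotZr dotBl.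
rewrite ger0_norm ?invr_ge0// (exprS _ k).
set D := enorm (y - x); set e := 2^-1 ^+ k.
by lra.
Qed.

Lemma quadratic_upper_bound x y :
  F y <= F x + dot (G x) (y - x) + l / 2 * enorm (x - y) ^+ 2.
Proof.
set c := l / 2 * enorm (x - y) ^+ 2.
have h k := quadratic_upper_bound_approx k x y; rewrite -/c in h.
have cv : (F x + dot (G x) (y - x) + (1 + 2^-1 ^+ k) * c) @[k --> \oo] -->
    F x + dot (G x) (y - x) + (1 + 0) * c.
  apply: cvgD; first exact: cvg_cst.
  apply: cvgMl; apply: cvgD; first exact: cvg_cst.
  by apply: cvg_expr; rewrite ger0_norm ?invr_ge0// invf_lt1// ltr1n.
rewrite addr0 mul1r in cv.
rewrite -(cvg_lim _ cv)//; apply: limr_ge; first by apply/cvg_ex; eexists; exact: cv.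
by apply: nearW => k; exact: h.
Qed.

Lemma modulus_le (x y : 'cV[R]_p) : x != y -> mu <= l.
Proof.
move=> xy; have := F_lower x y; have := quadratic_upper_bound x y.
have : 0 < enorm (x - y) ^+ 2.
  rewrite exprn_gt0// lt_neqAle enorm_ge0 andbT eq_sym.
  apply: contra_neq xy => /enorm_eq0/eqP; rewrite subr_eq0; exact/eqP.
by nra.
Qed.

(** Stepping from a minimizer along [- G] decreases the upper bound unless
[G] vanishes there. *)
Lemma critical_point z : 0 < l -> (forall y, F z <= F y) -> G z = 0.
Proof.
move=> l_gt0 z_min; apply: enorm_eq0; apply/eqP; rewrite -sqrf_eq0.
have := le_trans (z_min (z - l^-1 *: G z)) (quadratic_upper_bound z _).
have -> : z - l^-1 *: G z - z = - (l^-1 *: G z).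
  by rewrite addrAC subrr add0r.
rewrite subKr enormZ (ger0_norm (ltW _)) ?invr_gt0// !dot_lin -sqr_enorm.
rewrite eq_le sqr_ge0 andbT.
set D := enorm _ ^+ 2; rewrite exprMn -/D => h.
have : l^-1 * D <= 0.
  have e : l / 2 * (l^-1 ^+ 2 * D) = 2^-1 * (l^-1 * D) by field; rewrite gt_eqF.
  by rewrite e in h; lra.
by rewrite pmulr_rle0// invr_gt0.
Qed.

(** Co-coercivity of the gradient of [F - mu / 2 |.|^2].  Both bounds are
compared at the points [y + s u] and [x - s u].  The parameter [s] is optimal
when it is the inverse of [l - mu]; if [l = mu], a large [s] shows that [u]
vanishes. *)
Lemma cocoercive x y (d := x - y) (u := G x - G y - mu *: d) :
  mu <= l -> dot u u <= (l - mu) * dot u d.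
Proof.
move=> mul.
have dE : d = x - y by [].
have uE : u = G x - G y - mu *: d by [].
clearbody u; clearbody d.
have key s : (2 * s - (l - mu) * s ^+ 2) * dot u u <= dot u d.
  have := le_trans (F_lower x (y + s *: u)) (quadratic_upper_bound y _).
  have := le_trans (F_lower y (x - s *: u)) (quadratic_upper_bound x _).
  have -> : y + s *: u - x = s *: u - d.
    by rewrite dE; apply/colP => i; rewrite !mxE; ring.
  have -> : x - (y + s *: u) = d - s *: u.
    by rewrite dE; apply/colP => i; rewrite !mxE; ring.
  have -> : y + s *: u - y = s *: u by rewrite addrAC subrr add0r.
  have -> : y - (y + s *: u) = - (s *: u) by rewrite opprD addrA subrr add0r.
  have -> : x - s *: u - y = d - s *: u by rewrite dE addrAC.
  have -> : y - (x - s *: u) = s *: u - d.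
    by rewrite dE; apply/colP => i; rewrite !mxE; ring.
  have -> : x - s *: u - x = - (s *: u) by rewrite addrAC subrr add0r.
  have -> : x - (x - s *: u) = s *: u by rewrite subKr.
  rewrite !sqr_enorm !dot_lin.
  have ud : dot (G x) d - dot (G y) d = dot u d + mu * dot d d.
    by rewrite uE !dot_lin; ring.
  have uu : dot (G x) u - dot (G y) u = dot u u + mu * dot d u.
    by rewrite {3}uE !dot_lin; ring.
  move: ud (congr1 ( *%R s) uu); rewrite (dotC d u); lra.
have [lmu|lmu] := eqVneq l mu; last first.
  have lmu0 : 0 < l - mu by rewrite subr_gt0 lt_neqAle eq_sym lmu.
  have := key (l - mu)^-1.
  have -> : 2 * (l - mu)^-1 - (l - mu) * (l - mu)^-1 ^+ 2 = (l - mu)^-1.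
    by field; rewrite gt_eqF.
  by rewrite mulrC ler_pdivrMr// mulrC.
rewrite lmu subrr mul0r leNgt; apply/negP => u_gt0.
have := key ((dot u d + 1) / dot u u); rewrite lmu subrr mul0r subr0.
have -> : 2 * ((dot u d + 1) / dot u u) * dot u u = 2 * (dot u d + 1).
  by field; rewrite gt_eqF.
have := key 0; rewrite expr0n /= !mulr0 subrr mul0r; lra.
Qed.

(** With [c] the midpoint of [mu] and [l] and [r] half their distance,
co-coercivity says that [G x] lies in the ball of radius [r |d|] around [c d]. *)
Lemma gradient_step_contraction x z eta : mu <= l -> 0 <= eta -> G z = 0 ->
  enorm (x - z - eta *: G x) <=
    Order.max `|1 - mu * eta| `|1 - l * eta| * enorm (x - z).
Proof.
move=> mul eta0 Gz; have := cocoercive x z mul; rewrite Gz subr0.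
move: (x - z) (G x) => d g coc.
set c := (mu + l) / 2; set r := (l - mu) / 2.
have r0 : 0 <= r by rewrite divr_ge0// subr_ge0.
have ball : enorm (g - c *: d) <= r * enorm d.
  have rd : 0 <= r * enorm d by rewrite mulr_ge0 ?enorm_ge0.
  rewrite -ler_sqr ?nnegrE ?enorm_ge0// exprMn !sqr_enorm.
  by move: coc; rewrite !dot_lin (dotC d g) /c /r; lra.
have -> : d - eta *: g = (1 - eta * c) *: d - eta *: (g - c *: d).
  by apply/colP => i; rewrite !mxE; ring.
apply: (le_trans (is_normB _ _ (enorm_is_norm _ _))).
rewrite !enormZ (ger0_norm eta0).
apply: le_trans (_ : (`|1 - eta * c| + eta * r) * enorm d <= _).
  by rewrite mulrDl lerD2l -mulrA ler_wpM2l.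
rewrite ler_wpM2r ?enorm_ge0// le_max.
have [h|h] := leP 0 (1 - eta * c).
  apply/orP; left; rewrite (ger0_norm h); apply: le_trans (ler_norm _).
  by rewrite /c /r; lra.
apply/orP; right; rewrite (ltr0_norm h) -normrN.
by apply: le_trans (ler_norm _); rewrite /c /r; lra.
Qed.

End SmoothStronglyConvex.

(** * Stacked vectors *)

Section Stacking.
Variables (R : realType) (n p : nat).
Implicit Types (M N : 'M[R]_n) (u v : 'cV[R]_(n * p)).

Lemma kronIM M N : kronI p (M *m N) = kronI p M *m kronI p N.
Proof. by rewrite /kronI tensmx_mul mulmx1. Qed.

Lemma kronI_tr M : (kronI p M)^T = kronI p M^T.
Proof. by rewrite /kronI trmx_tens trmx1. Qed.

Lemma kronIE M i j a b :
  kronI p M (mxtens_index (i, a)) (mxtens_index (j, b)) = M i j * (a == b)%:R.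
Proof. by rewrite tensmxE mxE. Qed.

Lemma sum_mxtens (V : nmodType) (F : 'I_(n * p) -> V) :
  \sum_k F k = \sum_i \sum_a F (mxtens_index (i, a)).
Proof.
rewrite pair_big /= (reindex (@mxtens_index n p)) /=.
  by apply: eq_bigr => -[].
by exists (@mxtens_unindex n p) => i _; rewrite (mxtens_indexK, mxtens_unindexK).
Qed.

Lemma eq_block u v : block u =1 block v -> u = v.
Proof.
move=> uv; apply/colP => k; case: (mxtens_indexP k) => i a.
by have /colP/(_ a) := uv i; rewrite !mxE.
Qed.

Lemma blockD u v i : block (u + v) i = block u i + block v i.
Proof. by apply/colP => a; rewrite !mxE. Qed.

Lemma blockN u i : block (- u) i = - block u i.
Proof. by apply/colP => a; rewrite !mxE. Qed.

Lemma blockB u v i : block (u - v) i = block u i - block v i.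
Proof. by rewrite blockD blockN. Qed.

Lemma block_stack (w : 'I_n -> 'cV[R]_p) i : block (stack w) i = w i.
Proof. by apply/colP => a; rewrite mxE /stack mxE mxtens_indexK. Qed.

Lemma block_rep (z : 'cV[R]_p) i : block (rep n z) i = z.
Proof.
apply/colP => a; rewrite mxE /rep mxE mxtens_indexK mxE mul1r.
by congr (z _ _); apply: ord1.
Qed.

Lemma block_kronI M u i : block (kronI p M *m u) i = \sum_j M i j *: block u j.
Proof.
apply/colP => a; rewrite mxE mxE sum_mxtens summxE.
apply: eq_bigr => j _; rewrite (bigD1 a)//= big1 ?addr0.
  by rewrite kronIE eqxx mulr1 !mxE.
by move=> b ba; rewrite kronIE eq_sym (negbTE ba) mulr0 mul0r.
Qed.

Lemma block_kronD (a : 'cV[R]_n) u i : block (kronD p a *m u) i = a i 0 *: block u i.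
Proof.
rewrite block_kronI (bigD1 i)//= big1 ?addr0.
  by rewrite !mxE eqxx mulr1n.
by move=> j ji; rewrite !mxE eq_sym (negbTE ji) mulr0n scale0r.
Qed.

Lemma sqr_enorm_block u : enorm u ^+ 2 = \sum_i enorm (block u i) ^+ 2.
Proof.
rewrite sqr_enorm dotE sum_mxtens; apply: eq_bigr => i _.
by rewrite sqr_enorm dotE; apply: eq_bigr => a _; rewrite !mxE.
Qed.

Lemma ler_enorm_block (c : R) u v : 0 <= c ->
  (forall i, enorm (block u i) <= c * enorm (block v i)) ->
  enorm u <= c * enorm v.
Proof.
move=> c0 uv; rewrite -ler_sqr ?nnegrE ?mulr_ge0 ?enorm_ge0//.
rewrite exprMn !sqr_enorm_block mulr_sumr; apply: ler_sum => i _.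
by rewrite -exprMn ler_sqr ?nnegrE ?mulr_ge0 ?enorm_ge0.
Qed.

Lemma enorm_rep (z : 'cV[R]_p) : enorm (rep n z) = Num.sqrt n%:R * enorm z.
Proof.
apply/eqP; rewrite -(eqrXn2 (n := 2)) ?mulr_ge0 ?sqrtr_ge0 ?enorm_ge0//. 
rewrite exprMn [Num.sqrt n%:R ^+ 2]sqr_sqrtr ?ler0n// sqr_enorm_block.
under eq_bigr => i _ do rewrite block_rep.
by rewrite sumr_const card_ord mulr_natl.
Qed.

(** Cauchy-Schwarz against the all-ones vector. *)
Lemma sum_enorm_block u : \sum_i enorm (block u i) <= Num.sqrt n%:R * enorm u.
Proof.
have := dot_le_enorm (ones : 'cV[R]_n) (\col_i enorm (block u i)).
rewrite dotE; under eq_bigr => i _ do rewrite !mxE mul1r.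
congr (_ <= _ * _); rewrite /enorm; congr (Num.sqrt _).
  by under eq_bigr => i _ do rewrite mxE expr1n; rewrite sumr_const card_ord.
have := sqr_enorm_block u; rewrite /enorm.
rewrite sqr_sqrtr; last by apply: sumr_ge0 => k _; exact: sqr_ge0.
by move=> ->; apply: eq_bigr => i _; rewrite !mxE.
Qed.

Lemma le_vmax (a : 'cV[R]_n) i : a i 0 <= vmax a.
Proof. by rewrite /vmax (bigD1 i)//= le_max lexx. Qed.

Lemma vmax_ge0 (a : 'cV[R]_n) : 0 <= vmax a.
Proof. by rewrite /vmax; elim/big_rec: _ => // i z _ z0; rewrite le_max z0 orbT. Qed.

Lemma enorm_kronD (a : 'cV[R]_n) u : (forall i, 0 <= a i 0) ->
  enorm (kronD p a *m u) <= vmax a * enorm u.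
Proof.
move=> a0; apply: ler_enorm_block; first exact: vmax_ge0.
move=> i; rewrite block_kronD enormZ ger0_norm//.
by rewrite ler_wpM2r ?enorm_ge0// le_vmax.
Qed.

End Stacking.

(** * Limits of powers of stochastic matrices *)

Definition pow_entries_cvg (R : realType) m (X L : 'M[R]_m) :=
  forall i j, (X ^+ k) i j @[k --> \oo] --> L i j.

Lemma pow_entries_cvg_tr (R : realType) m (X L : 'M[R]_m) :
  pow_entries_cvg X L -> pow_entries_cvg X^T L^T.
Proof.
move=> XL i j; rewrite mxE.
suff -> : (fun k => (X^T ^+ k) i j) = (fun k => (X ^+ k) j i) by exact: XL.
apply/funext => k.
elim: k i j => [|k IH] i j; first by rewrite !expr0 !mxE eq_sym.
by rewrite exprSr exprS -!mulmxE !mxE; apply: eq_bigr => l _; rewrite IH mxE mulrC.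
Qed.

Section PowerLimit.
Variables (R : realType) (m : nat) (X L : 'M[R]_m).
Hypothesis XL : pow_entries_cvg X L.

Let fix_expl q (W : 'M[R]_(m, q)) k : X *m W = W -> X ^+ k *m W = W.
Proof.
move=> XW; elim: k => [|k IH]; first by rewrite expr0 mul1mx.
by rewrite exprSr -mulmxE -mulmxA XW.
Qed.

Lemma pow_limit_fixl q (W : 'M[R]_(m, q)) : X *m W = W -> L *m W = W.
Proof.
move=> XW; apply/matrixP => i j.
have h : (X ^+ k *m W) i j @[k --> \oo] --> (L *m W) i j.
  rewrite mxE; under eq_fun do rewrite mxE.
  by apply: cvg_big => [|l _]; [exact: add_continuous|apply: cvgMl; exact: XL].
have h' : (X ^+ k *m W) i j @[k --> \oo] --> W i j.
  by under eq_fun do rewrite fix_expl//; exact: cvg_cst.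
exact: (cvg_unique _ h h').
Qed.

Lemma pow_limit_mull : X *m L = L.
Proof.
apply/matrixP => i j.
have h : (X *m X ^+ k) i j @[k --> \oo] --> (X *m L) i j.
  rewrite mxE; under eq_fun do rewrite mxE.
  by apply: cvg_big => [|l _]; [exact: add_continuous|apply: cvgMr; exact: XL].
have h' : (X *m X ^+ k) i j @[k --> \oo] --> L i j.
  under eq_fun do rewrite mulmxE -exprS.
  by have := @XL i j; rewrite -(cvg_shiftS (fun k => (X ^+ k) i j)).
exact: (cvg_unique _ h h').
Qed.

Lemma pow_limit_ge0 : (forall i j, 0 <= X i j) -> forall i j, 0 <= L i j.
Proof.
move=> X0 i j.
have Xk k a b : 0 <= (X ^+ k) a b.
  elim: k a b => [|k IH] a b; first by rewrite expr0 mxE ler0n.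
  by rewrite exprS -mulmxE mxE sumr_ge0// => c _; rewrite mulr_ge0.
rewrite -(cvg_lim _ (@XL i j))//.
by apply: limr_ge; [apply/cvg_ex; eexists; exact: XL|apply: nearW => k].
Qed.

End PowerLimit.

Section PowerLimitRight.
Variables (R : realType) (m : nat) (X L : 'M[R]_m).
Hypothesis XL : pow_entries_cvg X L.

Lemma pow_limit_fixr q (W : 'M[R]_(q, m)) : W *m X = W -> W *m L = W.
Proof.
move=> WX; apply: trmx_inj; rewrite trmx_mul.
by apply: (pow_limit_fixl (pow_entries_cvg_tr XL)); rewrite -trmx_mul WX.
Qed.

Lemma pow_limit_mulr : L *m X = L.
Proof.
apply: trmx_inj; rewrite trmx_mul.
exact: pow_limit_mull (pow_entries_cvg_tr XL).
Qed.

End PowerLimitRight.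

(** A contraction towards [lim_pow X v] is impossible at a non-zero fixed
vector of [X] when the powers of [X] diverge, since then [lim_pow X] is the
default value [0]. *)
Lemma contraction_lim_pow (R : realType) m (X : 'M[R]_m) N (sigma : R)
    (v : 'cV[R]_m) :
  is_norm N -> sigma < 1 ->
  (forall u, N (X *m u - lim_pow X *m u) <= sigma * N (u - lim_pow X *m u)) ->
  X *m v = v -> v != 0 -> pow_entries_cvg X (lim_pow X).
Proof.
move=> NN sigma1 contr Xv v0.
have [cv i j|ncv] := pselect (cvg (X ^+ k @[k --> \oo])).
  have XL : X ^+ k @[k --> \oo] --> lim_pow X by exact: cv.
  have Lij := @coord_continuous R m m i j (lim_pow X).
  exact: (@cvg_comp _ _ _ (fun k => X ^+ k) (fun M : 'M[R]_m => M i j) _ _ _ XL Lij).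
have L0 : lim_pow X = 0.
  by rewrite /lim_pow (dvgP ncv); apply/matrixP => i j; rewrite !mxE.
have := contr v; rewrite L0 mul0mx !subr0 Xv.
have Nv : 0 < N v.
  rewrite lt_neqAle is_norm_ge0// andbT eq_sym.
  by apply: contra_neq v0; case: NN => _ _; exact.
rewrite leNgt => /negP[]; rewrite -subr_gt0 -[X in X - _]mul1r -mulrBl.
by rewrite mulr_gt0 ?subr_gt0.
Qed.

Section StronglyConnectedWeights.
Variables (R : realType) (n p : nat) (E : rel 'I_n) (A : 'M[R]_n).
Hypotheses (E_sc : strongly_connected E) (A_row : row_stochastic_weights E A).

Lemma row_weights_ge0 i j : 0 <= A i j.
Proof.
by case: A_row => _ Apos A0; have [/Apos/ltW|/A0->] := boolP (j \in N_in E i).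
Qed.

Lemma row_weights_gt0 i j : E i j -> 0 < A i j.
Proof. by case: A_row => _ Apos _ Eij; apply: Apos; rewrite inE Eij orbT. Qed.

(** The maximum principle: a maximal entry is an average of the entries of its
in-neighbours, which are therefore maximal too. *)
Lemma fixed_constant (c : 'I_n -> R) :
  (forall i, \sum_j A i j * c j = c i) -> forall i j, c i = c j.
Proof.
move=> Ac i0.
pose k := [arg max_(i > i0) c i]%O.
have kmax i : c i <= c k by rewrite /k; case: arg_maxP => // m _; exact.
have step i j : c i = c k -> E i j -> c j = c k.
  move=> ik Eij; have : \sum_j A i j * (c k - c j) = 0.
    under eq_bigr do rewrite mulrBr.
    rewrite sumrB Ac -mulr_suml; case: A_row => -> _ _.
    by rewrite mul1r ik subrr.
  move=> /psumr_eq0P h; have /eqP : A i j * (c k - c j) = 0.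
    by apply: h => // l _; rewrite mulr_ge0 ?row_weights_ge0// subr_ge0.
  by rewrite mulf_eq0 gt_eqF ?row_weights_gt0//= subr_eq0 => /eqP.
have all_max i : c i = c k.
  have /connectP[s] := E_sc k i.
  suff: forall l, c l = c k -> path E l s -> i = last l s -> c i = c k by exact.
  elim: s => [|j s IH] l lk /=; first by move=> _ ->.
  by case/andP => /(step _ _ lk) jk; exact: IH.
by move=> j; rewrite !all_max.
Qed.

(** In the Markov chain with transitions [A], a state of mass 0 is entered only
from states of mass 0. *)
Lemma stationary_gt0 (pi : 'cV[R]_n) :
  pi^T *m A = pi^T -> (pi^T *m ones) 0 0 = 1 -> (forall i, 0 <= pi i 0) ->
  forall i, 0 < pi i 0.
Proof.
move=> piA pi1 pi0 i; rewrite lt_neqAle pi0 andbT eq_sym; apply/negP => /eqP i0.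
have step k j : pi j 0 = 0 -> E k j -> pi k 0 = 0.
  move=> j0 /row_weights_gt0 Akj; have /rowP/(_ j) := piA.
  rewrite !mxE j0; under eq_bigr do rewrite mxE.
  move=> /psumr_eq0P h; have /eqP : pi k 0 * A k j = 0.
    by apply: h => // l _; rewrite mulr_ge0 ?row_weights_ge0.
  by rewrite mulf_eq0 (gt_eqF Akj) orbF => /eqP.
have all0 k : pi k 0 = 0.
  have /connectP[s] := E_sc k i; elim: s k => [|j s IH] k /=.
    by move=> _ <-.
  by case/andP => Ekj sj lj; apply: (step k j) => //; exact: IH.
move: pi1; rewrite mxE big1 => [/esym/eqP|j _]; first by rewrite oner_eq0.
by rewrite mxE all0 mul0r.
Qed.

Variable pi : 'cV[R]_n.
Hypotheses (piA : pi^T *m A = pi^T) (pi1 : (pi^T *m ones) 0 0 = 1).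

(** The projection [1 pi^T] fixes the columns of the limit, which are constant
by the maximum principle, and it absorbs [A] on the right, hence also the
limit. *)
Lemma stochastic_pow_limit (L : 'M[R]_(n * p)) :
  pow_entries_cvg (kronI p A) L -> L = kronI p (ones *m pi^T).
Proof.
move=> AL; set P := kronI p _.
have PA : P *m kronI p A = P by rewrite /P -kronIM -mulmxA piA.
rewrite -(pow_limit_fixr AL PA); apply/esym/matrixP => k l.
have Lc i j a : L (mxtens_index (i, a)) l = L (mxtens_index (j, a)) l.
  apply: (fixed_constant (c := fun i => L (mxtens_index (i, a)) l)) => {}i.
  rewrite -[in RHS](pow_limit_mull AL) mxE sum_mxtens; apply: eq_bigr => {}j _.
  rewrite (bigD1 a)//= big1 ?addr0; first by rewrite kronIE eqxx mulr1.
  by move=> b ba; rewrite kronIE eq_sym (negbTE ba) mulr0 mul0r.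
case: (mxtens_indexP k) => i a; rewrite mxE sum_mxtens.
transitivity (\sum_j pi j 0 * L (mxtens_index (i, a)) l).
  apply: eq_bigr => j _; rewrite (bigD1 a)//= big1 ?addr0.
    by rewrite kronIE eqxx mulr1 mxE big_ord1 !mxE mul1r (Lc i j).
  by move=> b ba; rewrite kronIE eq_sym (negbTE ba) mulr0 mul0r.
rewrite -mulr_suml; move: pi1; rewrite mxE.
by under eq_bigr do rewrite !mxE mulr1; move=> ->; rewrite mul1r.
Qed.

Lemma stochastic_pow_limit_gt0 (L : 'M[R]_(n * p)) :
  (0 < p)%N -> pow_entries_cvg (kronI p A) L -> forall i, 0 < pi i 0.
Proof.
move=> p0 AL; apply: stationary_gt0 => // i.
have a : 'I_p := Ordinal p0.
have := pow_limit_ge0 AL _ (mxtens_index (i, a)) (mxtens_index (i, a)).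
rewrite (stochastic_pow_limit AL) kronIE eqxx mulr1 mxE big_ord1 !mxE mul1r.
apply => k l; case: (mxtens_indexP k) => j b; case: (mxtens_indexP l) => j' b'.
by rewrite kronIE mulr_ge0 ?row_weights_ge0// ler0n.
Qed.

End StronglyConnectedWeights.

(** * Non-negative matrices *)

Lemma positive_lower_bound (R : realType) m (F : 'I_m -> R) :
  (forall i, 0 < F i) -> exists2 c, 0 < c & forall i, c <= F i.
Proof.
move=> F0; exists (\big[Order.min/1]_i F i).
  by elim/big_ind: _ => // a b a0 b0; rewrite lt_min a0.
by move=> i; rewrite (bigD1 i)//= ge_min lexx.
Qed.

Section NonNegativeMatrix.
Variables (R : realType) (m : nat) (P : 'M[R]_m).
Hypothesis P_ge0 : forall i j, 0 <= P i j.

(** A left eigenvector [v] for [z] is tested against [delta]: the weights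
[|v i| delta i] have a positive sum, which is multiplied by at least [|z|] and
by at most [c]. *)
Lemma eigenvalue_le (delta : 'cV[R]_m) (c : R) (z : R[i]) :
  (forall i, 0 < delta i 0) ->
  (forall i, (P *m delta) i 0 <= c * delta i 0) ->
  eigenvalue (map_mx (real_complex R) P) z -> Normc.normc z <= c.
Proof.
move=> d0 Pd /eigenvalueP[v vP v0].
set nv := fun i => Normc.normc (v 0 i).
have nv_ge0 i : 0 <= nv i by rewrite /nv; case: (v 0 i) => a b; exact: sqrtr_ge0.
have normc_sum (F : 'I_m -> R[i]) :
    Normc.normc (\sum_i F i) <= \sum_i Normc.normc (F i).
  apply: (big_ind2 (fun a b => Normc.normc a <= b)) => //.
    by rewrite Normc.normc0.
  move=> a b a' b' ab ab'; exact: le_trans (le_normcD _ _) (lerD ab ab').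
have zv j : Normc.normc z * nv j <= \sum_i nv i * P i j.
  have /rowP/(_ j) := vP; rewrite !mxE => e.
  rewrite /nv -Normc.normcM -e; apply: le_trans (normc_sum _) _.
  apply: ler_sum => i _; rewrite Normc.normcM mxE.
  by rewrite /= expr0n addr0 sqrtr_sqr ger0_norm.
have S0 : 0 < \sum_i nv i * delta i 0.
  rewrite lt_neqAle sumr_ge0 ?andbT => [|i _]; last by rewrite mulr_ge0 // ltW.
  apply: contra_neq v0 => /esym/psumr_eq0P h; apply/rowP => i; rewrite mxE.
  apply: Normc.eq0_normc; have /eqP : nv i * delta i 0 = 0.
    by apply: h => // j _; rewrite mulr_ge0 // ltW.
  by rewrite mulf_eq0 (gt_eqF (d0 i)) orbF => /eqP.
rewrite -(ler_pM2r S0) !mulr_sumr.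
apply: le_trans (_ : \sum_j (\sum_i nv i * P i j) * delta j 0 <= _).
  by apply: ler_sum => j _; rewrite mulrA ler_wpM2r// ltW.
under eq_bigr do rewrite mulr_suml.
rewrite exchange_big /=; apply: ler_sum => i _.
under eq_bigr do rewrite -mulrA.
rewrite -mulr_sumr mulrCA ler_wpM2l//.
by have := Pd i; rewrite mxE.
Qed.

Lemma right_eigenvalue (w : 'cV[R]_m) (r : R) :
  w != 0 -> P *m w = r *: w -> eigenvalue (map_mx (real_complex R) P) r%:C%C.
Proof.
move=> w0 Pw; rewrite eigenvalue_map /eigenvalue /eigenspace kermx_eq0.
rewrite row_free_unit; apply: contra_neqN w0 => Pr.
by rewrite -(mulKmx Pr w) mulmxBl Pw mul_scalar_mx subrr mulmx0.
Qed.

Lemma ler_mulmx_col (u v : 'cV[R]_m) : (forall i, u i 0 <= v i 0) ->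
  forall i, (P *m u) i 0 <= (P *m v) i 0.
Proof. by move=> uv i; rewrite !mxE ler_sum// => j _; rewrite ler_wpM2l. Qed.

(** The initial vector is dominated by a multiple of [w], and domination by
[r ^ k w] is inherited since [P] is monotone. *)
Lemma geometric_bound (w : 'cV[R]_m) (r : R) (t : nat -> 'cV[R]_m) :
  (forall i, 0 < w i 0) -> P *m w = r *: w ->
  (forall k i, t k.+1 i 0 <= (P *m t k) i 0) ->
  exists2 C, 0 <= C & forall k i, t k i 0 <= C * r ^+ k * w i 0.
Proof.
move=> w0 Pw tP; pose c i := `|t 0%N i 0| / w i 0.
have c0 i : 0 <= c i by rewrite divr_ge0// ltW.
exists (\sum_i c i); first exact: sumr_ge0.
elim=> [|k IH] i.
  rewrite expr0 mulr1 -ler_pdivrMr// (bigD1 i)//=.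
  apply: le_trans (_ : c i <= _).
    by rewrite /c ler_wpM2r ?ler_norm// invr_ge0 ltW.
  by rewrite lerDl sumr_ge0.
apply: (le_trans (tP k i)).
have IH' j : t k j 0 <= (((\sum_i c i) * r ^+ k) *: w) j 0 by rewrite mxE IH.
apply: (le_trans (ler_mulmx_col IH' i)).
by rewrite -scalemxAr Pw !mxE exprSr !mulrA.
Qed.

End NonNegativeMatrix.

Section SpectralRadius.
Variables (R : realType) (m : nat) (P : 'M[R]_m) (delta : 'cV[R]_m).
Hypothesis P_ge0 : forall i j, 0 <= P i j.
Hypothesis delta_gt0 : forall i, 0 < delta i 0.
Hypothesis P_delta : forall i, (P *m delta) i 0 < delta i 0.

Let moduli := [set Normc.normc z | z in
  [set z : R[i] | eigenvalue (map_mx (real_complex R) P) z]].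

Let moduli_le : exists2 c, c < 1 & ubound moduli c.
Proof.
have [i|e e0 eP] :=
    @positive_lower_bound R m (fun i => (delta i 0 - (P *m delta) i 0) / delta i 0).
  by rewrite divr_gt0// subr_gt0.
exists (1 - e); first by rewrite ltrBlDr ltrDl.
move=> _ [z zP <-]; apply: (eigenvalue_le P_ge0 delta_gt0 _ zP) => i.
by have := eP i; rewrite ler_pdivlMr//; lra.
Qed.

(** By finiteness the strict inequalities [P delta < delta] leave a uniform
margin, and [eigenvalue_le] bounds all the moduli away from 1. *)
Lemma spectral_radius_lt1 : spectral_radius P < 1.
Proof.
have [c c1 cP] := moduli_le; rewrite /spectral_radius -/moduli.
have [->|/set0P m0] := eqVneq moduli set0; first by rewrite sup0.
exact: le_lt_trans (ge_sup m0 cP) c1.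
Qed.

Lemma eigenvalue_le_spectral_radius r : 0 <= r ->
  eigenvalue (map_mx (real_complex R) P) r%:C%C -> r <= spectral_radius P.
Proof.
move=> r0 rP; have [c _ cP] := moduli_le.
apply: ub_le_sup; first by exists c.
by exists r%:C%C => //=; rewrite expr0n addr0 sqrtr_sqr ger0_norm.
Qed.

End SpectralRadius.

Section Perron.
Variables (R : realType) (m : nat) (P : 'M[R]_m) (j0 : 'I_m).
Hypothesis P_ge0 : forall i j, 0 <= P i j.
Hypothesis P_col : forall j, (forall i, 0 < P i j) \/ (forall i, P i j = 0).
Hypothesis P_j0 : forall i, 0 < P i j0.

(** Normalising [v] to the simplex makes the set compact; the condition is kept
without division, so that it is closed even where [v] has zero entries. *)
Let subeigen : set (R * 'rV[R]_m) :=
  [set cv : R * 'rV[R]_m | [/\ forall i, cv.1 * cv.2 0 i <= \sum_j P i j * cv.2 0 j,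
                \sum_j cv.2 0 j = 1, 0 <= cv.1 & forall j, 0 <= cv.2 0 j]].

Let entry_le1 cv j : subeigen cv -> cv.2 0 j <= 1.
Proof.
by case=> _ <- _ v0; rewrite (bigD1 j)//= lerDl sumr_ge0.
Qed.

Let subeigen_le cv : subeigen cv -> cv.1 <= \sum_i \sum_j P i j.
Proof.
move=> Kcv; case: (Kcv) => cP v1 c0 v0.
rewrite -[cv.1]mulr1 -v1 mulr_sumr; apply: ler_sum => i _.
apply: le_trans (cP i) _; apply: ler_sum => j _.
by rewrite ler_piMr ?entry_le1.
Qed.

Let subeigen_compact : compact subeigen.
Proof.
pose box := `[0, \sum_i \sum_j P i j]%classic `*`
  [set v : 'rV[R]_m | forall i, `[0, 1]%classic (v ord0 i)].
have boxc : compact box.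
  apply: compact_setX; first exact: segment_compact.
  apply: (@rV_compact R m (fun=> `[0, 1]%classic)) => i.
  exact: segment_compact.
apply: (subclosed_compact _ boxc); last first.
  move=> cv Kcv; case: (Kcv) => _ _ c0 v0; split => /=.
    by rewrite in_itv /= c0 subeigen_le.
  by move=> i; rewrite in_itv /= v0 entry_le1.
have cc : continuous (fun cv : R * 'rV[R]_m => cv.1) by move=> cv; exact: cvg_fst.
have cs j : continuous (fun cv : R * 'rV[R]_m => cv.2 0 j).
  move=> cv; have vj := @coord_continuous R 1 m 0 j cv.2.
  exact: (@cvg_comp _ _ _ snd (fun v : 'rV[R]_m => v 0 j) _ _ _ cvg_snd vj).
have -> : subeigen =
    \bigcap_i [set cv : R * 'rV[R]_m | 0 <= \sum_j P i j * cv.2 0 j - cv.1 * cv.2 0 i] `&`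
    [set cv : R * 'rV[R]_m | \sum_j cv.2 0 j = 1] `&` [set cv | 0 <= cv.1] `&`
    \bigcap_j [set cv : R * 'rV[R]_m | 0 <= cv.2 0 j].
  apply/seteqP; split => [cv [h1 h2 h3 h4]|cv [[[h1 h2] h3] h4]].
    split; last by move=> j _; exact: h4.
    by split; [split => // i _ /=; rewrite subr_ge0|].
  by split => // i; [have := h1 i I; rewrite /= subr_ge0|exact: h4 i I].
apply: closedI; [apply: closedI; [apply: closedI|]|].
- apply: closed_bigI => i _; apply: (closed_comp _ (@closed_ge R 0)) => cv _.
  apply: cvgB; last by apply: cvgM; [exact: cc|exact: cs].
  apply: cvg_big; first exact: add_continuous.
  by move=> j _; apply: cvgMr; exact: cs.
- apply: (closed_comp _ (@closed_eq R 1)) => cv _.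
  by apply: cvg_big; [exact: add_continuous|move=> j _; exact: cs].
- by apply: (closed_comp _ (@closed_ge R 0)) => cv _; exact: cc.
- by apply: closed_bigI => i _; apply: (closed_comp _ (@closed_ge R 0)) => cv _; exact: cs.
Qed.

Let exists_maximal : exists cv, [/\ subeigen cv, 0 < cv.1 &
  forall cv', subeigen cv' -> cv'.1 <= cv.1].
Proof.
have K0 : subeigen (P j0 j0, delta_mx 0 j0).
  split => //=.
  - move=> i; rewrite (bigD1 j0)//= big1 ?addr0 => [|j jj]; last first.
      by rewrite !mxE (negbTE jj) andbF mulr0.
    rewrite !mxE !eqxx mulr1 /=.
    by case: eqP => [->|_]; rewrite ?mulr1// mulr0.
  - rewrite (bigD1 j0)//= big1 ?addr0 => [|j jj]; last by rewrite !mxE (negbTE jj) andbF.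
    by rewrite !mxE !eqxx.
  - by move=> j; rewrite !mxE ler0n.
have [||[r v] /[!inE] Krv rmax] :=
    @compact_EVT_max _ R (fun cv => cv.1) subeigen _ subeigen_compact.
- by eexists; exact: K0.
- by apply: continuous_subspaceT => cv; exact: cvg_fst.
exists (r, v); split => //=.
  by apply: lt_le_trans (P_j0 j0) _; apply: (rmax (P j0 j0, _)); rewrite inE; exact: K0.
by move=> cv Kcv; apply: rmax; rewrite inE.
Qed.

(** A positive entry of the image needs a positive column, which contributes to
every other entry as well. *)
Let image_gt0 (u : 'I_m -> R) i : (forall j, 0 <= u j) ->
  0 < \sum_j P i j * u j -> forall i', 0 < \sum_j P i' j * u j.
Proof.
move=> u0 Pu i'.
have [j Pij] : exists j, 0 < P i j * u j.
  apply/existsP; rewrite -[[exists _, _]]negbK negb_exists.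
  apply/negP => /forallP h; have : \sum_j P i j * u j <= 0.
    by apply: sumr_le0 => j _; rewrite leNgt; exact: h.
  by rewrite leNgt Pu.
have uj : 0 < u j.
  by rewrite lt_neqAle u0 andbT; apply: contraTneq Pij => <-; rewrite mulr0 ltxx.
have Pi'j : 0 < P i' j.
  by case: (P_col j) => [//|] Pj; move: Pij; rewrite Pj mul0r ltxx.
rewrite (bigD1 j)//= ltr_wpDr ?mulr_gt0// sumr_ge0// => l _.
by rewrite mulr_ge0.
Qed.

(** Perron's theorem in the form of Collatz and Wielandt.  Let [(r, v)] be the
pair with [r v <= P v] and [v] in the simplex for which [r] is largest.  Then
[w = P v] is positive.  If [P w = r w] failed, then [P (P v - r v)] would be
positive, and a constant larger than [r] would be possible with [w]. *)
Theorem perron : exists r w,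
  [/\ 0 < r, forall i, 0 < (w : 'cV[R]_m) i 0 & P *m w = r *: w].
Proof.
have [[r v] /= [[/= rv v1 _ v0] r0 rmax]] := exists_maximal.
pose w i := \sum_j P i j * v 0 j.
have w0 : forall i, 0 < w i.
  have [i vi] : exists i, 0 < v 0 i.
    apply/existsP; rewrite -[[exists _, _]]negbK negb_exists.
    apply/negP => /forallP h; have : \sum_j v 0 j <= 0.
      by apply: sumr_le0 => j _; rewrite leNgt; exact: h.
    by rewrite v1 leNgt ltr01.
  apply: (image_gt0 (i := i)) => //; apply: lt_le_trans (rv i).
  exact: mulr_gt0.
pose u j := w j - r * v 0 j.
have u0 j : 0 <= u j by rewrite subr_ge0 rv.
have PuE i : \sum_j P i j * u j = \sum_j P i j * w j - r * w i.
  rewrite mulr_sumr -sumrB; apply: eq_bigr => j _; rewrite /u; ring.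
exists r, (\col_i w i); split => //; first by move=> i; rewrite mxE.
apply/colP => i; rewrite !mxE; under eq_bigr do rewrite mxE.
apply/eqP; rewrite -subr_eq0 -PuE; apply: contraT => Pui.
have Pu0 : forall i', 0 < \sum_j P i' j * u j.
  apply: (image_gt0 (i := i)) => //.
  by rewrite lt_neqAle eq_sym Pui sumr_ge0// => j _; rewrite mulr_ge0.
have [i'|e e0 eP] := @positive_lower_bound R m (fun i => (\sum_j P i j * u j) / w i).
  by rewrite divr_gt0.
have s0 : 0 < \sum_j w j by rewrite (bigD1 i)//= ltr_wpDr ?sumr_ge0// => j _; exact: ltW.
suff /rmax /= : subeigen (r + e, \row_j (w j / \sum_j w j)) by rewrite gerDl leNgt e0.
split => /=.
- move=> i'; rewrite mxE; under [in leRHS]eq_bigr do rewrite mxE mulrA.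
  rewrite -mulr_suml mulrA ler_wpM2r ?invr_ge0 ?(ltW s0)//.
  by have := eP i'; rewrite ler_pdivlMr// PuE; lra.
- by under eq_bigr do rewrite mxE; rewrite -mulr_suml divff// gt_eqF.
- by rewrite addr_ge0 ?(ltW r0) ?(ltW e0).
- by move=> j; rewrite mxE divr_ge0 ?ltW.
Qed.

End Perron.

(** * Weighted products of non-negative vectors *)

Section WeightedDot.
Variables (R : realType) (n : nat).
Implicit Types u v a : 'cV[R]_n.

Lemma weighted_dotE u a v :
  (u^T *m diag_mx a^T *m v) 0 0 = \sum_j u j 0 * a j 0 * v j 0.
Proof.
rewrite mxE; apply: eq_bigr => j _; congr (_ * _).
rewrite mxE (bigD1 j)//= big1 ?addr0; first by rewrite !mxE eqxx mulr1n.
by move=> i ij; rewrite !mxE (negbTE ij) mulr0n mulr0.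
Qed.

Lemma weighted_dot_ge0 u a v :
  (forall i, 0 <= u i 0) -> (forall i, 0 <= a i 0) -> (forall i, 0 <= v i 0) ->
  0 <= (u^T *m diag_mx a^T *m v) 0 0.
Proof.
by move=> u0 a0 v0; rewrite weighted_dotE sumr_ge0// => j _; rewrite !mulr_ge0.
Qed.

Lemma weighted_dot_le u a v :
  (forall i, 0 <= u i 0) -> (forall i, 0 <= v i 0) ->
  (u^T *m diag_mx a^T *m v) 0 0 <= vmax a * (u^T *m v) 0 0.
Proof.
move=> u0 v0; rewrite weighted_dotE mxE mulr_sumr; apply: ler_sum => j _.
by rewrite mxE [u j 0 * _]mulrC -mulrA ler_wpM2r ?le_vmax// mulr_ge0.
Qed.

Lemma vmin_le u i : vmin u <= u i 0.
Proof.
apply: inf_lbound; last by exists i.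
exists (- \sum_j `|u j 0|) => _ [j _ <-].
rewrite lerNl; apply: le_trans (ler_norm _) _.
by rewrite normrN (bigD1 j)//= lerDl sumr_ge0.
Qed.

Lemma vmin_gt0 u : (0 < n)%N -> (forall i, 0 < u i 0) -> 0 < vmin u.
Proof.
move=> n0 u0; have [c c0 cu] := positive_lower_bound u0.
apply: (lt_le_trans c0); apply: lb_le_inf.
  by exists (u (Ordinal n0) 0), (Ordinal n0).
by move=> _ [i _ <-].
Qed.

(** All terms are non-negative, and the term of an index at which [a] is maximal
already suffices. *)
Lemma weighted_dot_ge u a v :
  (forall i, 0 < u i 0) -> (forall i, 0 <= a i 0) -> (forall i, 0 < v i 0) ->
  vmin u * vmin v * vmax a <= (u^T *m diag_mx a^T *m v) 0 0.
Proof.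
move=> u0 a0 v0.
have T0 j : 0 <= u j 0 * a j 0 * v j 0 by rewrite !mulr_ge0// ltW.
rewrite {1}/vmax; apply: (big_ind (fun z => vmin u * vmin v * z <= _)).
- by rewrite mulr0 weighted_dot_ge0// => i; exact: ltW.
- by move=> b c bP cP; case: (leP b c).
move=> i _; have n0 : (0 < n)%N by case: i => i; exact: leq_ltn_trans.
rewrite weighted_dotE (bigD1 i)//= ler_wpDr ?sumr_ge0//.
rewrite [u i 0 * _ * _]mulrAC ler_wpM2r//.
by apply: ler_pM; rewrite ?vmin_le// ltW// vmin_gt0.
Qed.

End WeightedDot.

Section OuterProduct.
Variables (R : realType) (n p : nat).
Implicit Types u v : 'cV[R]_n.

Lemma kronI_outerE u v i j a b :
  kronI p (u *m v^T) (mxtens_index (i, a)) (mxtens_index (j, b)) =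
    u i 0 * v j 0 * (a == b)%:R.
Proof. by rewrite kronIE mxE big_ord1 mxE. Qed.

Lemma kronI_outer_neq0 u v : (0 < n)%N -> (0 < p)%N ->
  (forall i, 0 < u i 0) -> (forall i, 0 < v i 0) -> kronI p (u *m v^T) != 0.
Proof.
move=> n0 p0 u0 v0; pose k := mxtens_index (Ordinal n0, Ordinal p0).
apply/eqP => /matrixP/(_ k k); rewrite kronI_outerE eqxx mulr1 [RHS]mxE => /eqP.
by rewrite gt_eqF// mulr_gt0.
Qed.

Lemma kronI_outer_neq1 u v : (1 < n)%N -> (0 < p)%N ->
  (forall i, 0 < u i 0) -> (forall i, 0 < v i 0) ->
  1%:M - kronI p (u *m v^T) != 0.
Proof.
move=> n1 p0 u0 v0; pose a := Ordinal p0.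
pose i : 'I_n := Ordinal (ltnW n1); pose j : 'I_n := Ordinal n1.
apply/eqP => /matrixP/(_ (mxtens_index (i, a)) (mxtens_index (j, a))).
rewrite mxE [X in _ + X]mxE kronI_outerE eqxx mulr1 !mxE.
have -> : (mxtens_index (i, a) == mxtens_index (j, a)) = false.
  by apply/eqP => /(can_inj (@mxtens_indexK n p)).
by rewrite sub0r => /eqP; rewrite oppr_eq0 gt_eqF// mulr_gt0.
Qed.

Lemma kronI_outer_eq1 u v : (n <= 1)%N -> (v^T *m u) 0 0 = 1 ->
  kronI p (u *m v^T) = 1%:M.
Proof.
move=> n1 vu; have all_eq (i j : 'I_n) : i = j.
  have i0 (k : 'I_n) : k = 0%N :> nat.
    by apply/eqP; rewrite -leqn0 -ltnS (leq_trans (ltn_ord k)).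
  by apply: val_inj; rewrite /= !i0.
apply/matrixP => k k'; case: (mxtens_indexP k) => i a.
case: (mxtens_indexP k') => j b.
rewrite kronI_outerE [RHS]mxE (can_eq (@mxtens_indexK n p)) -pair_eqE /=.
rewrite (all_eq j i) eqxx /=; move: vu; rewrite mxE (bigD1 i)//= big1 ?addr0.
  by rewrite mxE mulrC => ->; rewrite mul1r.
by move=> l; rewrite (all_eq l i) eqxx.
Qed.

End OuterProduct.

(** * One step of the iteration *)

Section OneStep.
Variables (R : realType) (n p : nat).
Variables (E : rel 'I_n) (A B : 'M[R]_n) (pir pic : 'cV[R]_n).
Variables (f : 'I_n -> 'cV[R]_p -> R) (mus ls : 'cV[R]_n) (xs : 'cV[R]_p).
Variables (alpha beta : 'cV[R]_n) (x y : nat -> 'cV[R]_(n * p)).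
Variables (normA normB : 'cV[R]_(n * p) -> R).
Variables (sigmaA sigmaB c2A cA2 c2B cB2 : R).

Hypothesis p_gt0 : (0 < p)%N.
Hypothesis E_sc : strongly_connected E.
Hypothesis A_row : row_stochastic_weights E A.
Hypothesis B_col : column_stochastic_weights E B.
Hypothesis pirA : pir^T *m A = pir^T.
Hypothesis pir1 : (pir^T *m ones) 0 0 = 1.
Hypothesis Bpic : B *m pic = pic.
Hypothesis pic1 : ((ones : 'cV[R]_n)^T *m pic) 0 0 = 1.
Hypothesis mus_ge0 : forall i, 0 <= mus i 0.
Hypothesis f_sc : forall i, strongly_convex (mus i 0) (f i).
Hypothesis ls_gt0 : forall i, 0 < ls i 0.
Hypothesis f_smooth : forall i, smooth (ls i 0) (f i).
Hypothesis xs_min : unique_minimizer (average f) xs.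
Hypothesis alpha_ge0 : forall i, 0 <= alpha i 0.
Hypothesis beta_ge0 : forall i, 0 <= beta i 0.
Hypothesis xy : ABm A B alpha beta f x y.
Hypothesis normA_norm : is_norm normA.
Hypothesis normB_norm : is_norm normB.
Hypothesis sigmaA_lt1 : sigmaA < 1.
Hypothesis sigmaB_lt1 : sigmaB < 1.
Hypothesis contrA : forall v,
  normA (kronI p A *m v - lim_pow (kronI p A) *m v)
    <= sigmaA * normA (v - lim_pow (kronI p A) *m v).
Hypothesis contrB : forall v,
  normB (kronI p B *m v - lim_pow (kronI p B) *m v)
    <= sigmaB * normB (v - lim_pow (kronI p B) *m v).
Hypothesis cA2_gt0 : 0 < cA2.
Hypothesis cB2_gt0 : 0 < cB2.
Hypothesis c2AP : forall v, enorm v <= c2A * normA v.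
Hypothesis cA2P : forall v, normA v <= cA2 * enorm v.
Hypothesis c2BP : forall v, enorm v <= c2B * normB v.
Hypothesis cB2P : forall v, normB v <= cB2 * enorm v.

Local Notation Ainf := (lim_pow (kronI p A)).
Local Notation Binf := (lim_pow (kronI p B)).
Local Notation nR := (n%:R : R).
Local Notation mu := (nR^-1 * \sum_(i < n) mus i 0).
Local Notation l := (nR^-1 * \sum_(i < n) ls i 0).
Local Notation lbar := (vmax ls).
Local Notation abar := (vmax alpha).
Local Notation bbar := (vmax beta).
Local Notation pDp := ((pir^T *m diag_mx alpha^T *m pic) 0 0).
Local Notation pp := ((pir^T *m pic) 0 0).
Local Notation gradF z := (nR^-1 *: \sum_i grad (f i) z).
Local Notation consA k := (normA (x k - Ainf *m x k)).
Local Notation opt k := (enorm (Ainf *m x k - rep n xs)).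
Local Notation mom k := (enorm (x k - prev_iter x k)).
Local Notation consB k := (normB (y k - Binf *m y k)).

Lemma n_gt0 : (0 < n)%N.
Proof.
case: (posnP n) => // n0; move: pir1; rewrite mxE big1 => [/esym/eqP|i _].
  by rewrite oner_eq0.
by exfalso; case: i => i; rewrite n0.
Qed.

Let nR_neq0 : nR != 0.
Proof. by rewrite pnatr_eq0 -lt0n n_gt0. Qed.

(** ** The two averaging projections *)

Lemma kronI_rep (M : 'M[R]_n) z : M *m ones = ones -> kronI p M *m rep n z = rep n z.
Proof.
move=> M1; apply: eq_block => i; rewrite block_kronI block_rep.
under eq_bigr do rewrite block_rep.
rewrite -scaler_suml; have /colP/(_ i) := M1; rewrite !mxE.
by under eq_bigr do rewrite mxE mulr1; move=> ->; rewrite scale1r.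
Qed.

Let A_ones : A *m ones = ones.
Proof.
apply/colP => i; rewrite !mxE; case: A_row => A1 _ _; rewrite -[RHS](A1 i).
by apply: eq_bigr => j _; rewrite mxE mulr1.
Qed.

(** Column-stochastic weights are row-stochastic for the reversed graph, which
reduces [B] to the results on [A]. *)
Let Btr_row : row_stochastic_weights (fun i j => E j i) B^T.
Proof.
case: B_col => B1 Bpos B0; split => [i|i j|i j].
- by under eq_bigr do rewrite mxE; exact: B1.
- by move=> ij; rewrite mxE; apply: Bpos; move: ij; rewrite !inE.
- by move=> ij; rewrite mxE; apply: B0; move: ij; rewrite !inE.
Qed.

Let Etr_sc : strongly_connected (fun i j => E j i).
Proof. by move=> i j; rewrite connect_rev; exact: E_sc. Qed.

Lemma pow_kronIA_cvg : pow_entries_cvg (kronI p A) Ainf.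
Proof.
have [i0 a0] : 'I_n * 'I_p by split; [exact: Ordinal n_gt0|exact: Ordinal p_gt0].
apply: (contraction_lim_pow normA_norm sigmaA_lt1 contrA
  (kronI_rep (const_mx 1) A_ones)).
apply/eqP => /(congr1 (fun u => block u i0 a0 0)).
rewrite block_rep !mxE; exact/eqP/oner_neq0.
Qed.

Lemma pow_kronIB_cvg : pow_entries_cvg (kronI p B) Binf.
Proof.
have [i0 a0] : 'I_n * 'I_p by split; [exact: Ordinal n_gt0|exact: Ordinal p_gt0].
pose v : 'cV[R]_(n * p) := stack (fun i => const_mx (pic i 0)).
have vE i : block v i = const_mx (pic i 0) by exact: block_stack.
apply: (contraction_lim_pow normB_norm sigmaB_lt1 contrB (v := v)).
  apply: eq_block => i; rewrite block_kronI vE; apply/colP => a.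
  have /colP/(_ i) := Bpic; rewrite summxE !mxE => <-.
  by apply: eq_bigr => j _; rewrite vE !mxE.
apply/eqP => v0; move: pic1; rewrite mxE big1 => [/esym/eqP|i _].
  by rewrite oner_eq0.
have := vE i; rewrite v0 => /colP/(_ a0); rewrite !mxE => <-.
by rewrite mulr0.
Qed.

Lemma AinfE : Ainf = kronI p (ones *m pir^T).
Proof. exact: stochastic_pow_limit pow_kronIA_cvg. Qed.

Let kronIB_tr_cvg : pow_entries_cvg (kronI p B^T) Binf^T.
Proof. by rewrite -kronI_tr; exact: pow_entries_cvg_tr pow_kronIB_cvg. Qed.

Let pic_trB : pic^T *m B^T = pic^T.
Proof. by rewrite -trmx_mul Bpic. Qed.

Let pic_tr1 : (pic^T *m ones) 0 0 = 1.
Proof. by rewrite -[pic^T *m ones]trmxK mxE trmx_mul trmxK. Qed.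

Lemma BinfE : Binf = kronI p (pic *m ones^T).
Proof.
apply: trmx_inj; rewrite kronI_tr trmx_mul trmxK.
exact: (stochastic_pow_limit Etr_sc Btr_row pic_trB pic_tr1 kronIB_tr_cvg).
Qed.

Lemma pir_gt0 i : 0 < pir i 0.
Proof. exact: (stochastic_pow_limit_gt0 E_sc A_row pirA pir1 p_gt0 pow_kronIA_cvg). Qed.

Lemma pic_gt0 i : 0 < pic i 0.
Proof.
exact: (stochastic_pow_limit_gt0 Etr_sc Btr_row pic_trB pic_tr1 p_gt0 kronIB_tr_cvg).
Qed.

Lemma block_Ainf u i : block (Ainf *m u) i = \sum_j pir j 0 *: block u j.
Proof.
rewrite AinfE block_kronI; apply: eq_bigr => j _.
by rewrite mxE big_ord1 !mxE mul1r.
Qed.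

Lemma block_Binf u i : block (Binf *m u) i = pic i 0 *: \sum_j block u j.
Proof.
rewrite BinfE block_kronI scaler_sumr; apply: eq_bigr => j _.
by rewrite mxE big_ord1 !mxE mulr1.
Qed.

Lemma Ainf_kronIA : Ainf *m kronI p A = Ainf.
Proof. exact: pow_limit_mulr pow_kronIA_cvg. Qed.

Lemma kronIA_Ainf : kronI p A *m Ainf = Ainf.
Proof. exact: pow_limit_mull pow_kronIA_cvg. Qed.

Lemma Binf_kronIB : Binf *m kronI p B = Binf.
Proof. exact: pow_limit_mulr pow_kronIB_cvg. Qed.

(** ** The aggregate objective *)

Lemma average_lower z w :
  average f z + dot (gradF z) (w - z) + mu / 2 * enorm (z - w) ^+ 2 <= average f w.
Proof.
rewrite /average dotZl -mulrA -mulrA -!mulrDr ler_wpM2l ?invr_ge0 ?ler0n//.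
have -> : dot (\sum_i grad (f i) z) (w - z) = \sum_i dot (grad (f i) z) (w - z).
  by rewrite /dot linear_sum /= mulmx_suml summxE.
rewrite mulr_suml -!big_split /=; apply: ler_sum => i _.
by have := f_sc i z w; rewrite /dot mulrA.
Qed.

Lemma gradF_lip z w : enorm (gradF z - gradF w) <= l * enorm (z - w).
Proof.
rewrite -scalerBr -sumrB enormZ ger0_norm ?invr_ge0 ?ler0n// -mulrA.
rewrite ler_wpM2l ?invr_ge0 ?ler0n// mulr_suml.
apply: (le_trans (enorm_sum _ _ _)); apply: ler_sum => i _; exact: f_smooth.
Qed.

Lemma mu_ge0 : 0 <= mu.
Proof. by rewrite mulr_ge0 ?invr_ge0 ?ler0n ?sumr_ge0. Qed.

Lemma l_gt0 : 0 < l.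
Proof.
rewrite mulr_gt0 ?invr_gt0 ?ltr0n ?n_gt0//.
rewrite (bigD1 (Ordinal n_gt0))//= ltr_wpDr// sumr_ge0// => i _; exact: ltW.
Qed.

Lemma mu_le_l : mu <= l.
Proof.
have := modulus_le average_lower gradF_lip mu_ge0 (x := const_mx 1) (y := 0).
apply; apply/eqP => /colP/(_ (Ordinal p_gt0)); rewrite !mxE.
exact/eqP/oner_neq0.
Qed.

Lemma gradF_xs : gradF xs = 0.
Proof. exact: critical_point average_lower gradF_lip mu_ge0 _ l_gt0 xs_min.1. Qed.

Lemma sum_grad z : \sum_i grad (f i) z = nR *: gradF z.
Proof. by rewrite scalerA mulfV// scale1r. Qed.

(** ** Bounds on the gradients *)

Lemma grad_stack_lip u v :
  enorm (grad_stack f u - grad_stack f v) <= lbar * enorm (u - v).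
Proof.
apply: ler_enorm_block => [|i]; first exact: vmax_ge0.
rewrite !blockB !block_stack; apply: le_trans (f_smooth _ _ _) _.
by rewrite ler_wpM2r ?enorm_ge0// le_vmax.
Qed.

(** Gradient tracking: the sum of the blocks of [y k] is the sum of the local
gradients, because [B] preserves sums. *)
Lemma Binf_tracking k : Binf *m y k = Binf *m grad_stack f (x k).
Proof.
case: xy => y0 _ yS; elim: k => [|k IH]; first by rewrite y0.
by rewrite yS !mulmxDr mulmxN mulmxA Binf_kronIB IH addrAC subrr add0r.
Qed.

Lemma Binf_grad_xs : Binf *m grad_stack f (rep n xs) = 0.
Proof.
apply: eq_block => i; rewrite block_Binf.
under eq_bigr do rewrite block_stack block_rep.
by rewrite sum_grad gradF_xs !scaler0; apply/colP => a; rewrite !mxE.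
Qed.

Lemma enorm_sub_opt k : enorm (x k - rep n xs) <= c2A * consA k + opt k.
Proof.
rewrite -(subrKA (Ainf *m x k)); apply: le_trans (is_norm_triangle _ _ _) _.
  exact: enorm_is_norm.
by rewrite lerD2r.
Qed.

(** [Binf] annihilates the gradients at the minimizer, so the tracked part of
[y k] is controlled by the distance to it. *)
Lemma enorm_y k :
  enorm (y k) <= c2B * consB k + lbar * opnorm Binf * (c2A * consA k + opt k).
Proof.
rewrite -[y k](subrK (Binf *m y k)).
apply: le_trans (is_norm_triangle _ _ (@enorm_is_norm _ _)) _.
rewrite subrK; apply: lerD => //.
rewrite Binf_tracking -[Binf *m _]subr0 -Binf_grad_xs -mulmxBr.
apply: le_trans (enorm_mulmx _ _) _.
rewrite [lbar * _]mulrC -mulrA ler_wpM2l ?opnorm_ge0//.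
apply: le_trans (grad_stack_lip _ _) _.
by rewrite ler_wpM2l ?vmax_ge0// enorm_sub_opt.
Qed.

Let enormM_le q (M : 'M[R]_(q, n * p)) u c : enorm u <= c -> enorm (M *m u) <= opnorm M * c.
Proof.
by move=> uc; apply: le_trans (enorm_mulmx _ _) _; rewrite ler_wpM2l ?opnorm_ge0.
Qed.

Let enorm_step k : enorm (kronD p alpha *m y k) <=
  abar * (c2B * consB k + lbar * opnorm Binf * (c2A * consA k + opt k)).
Proof.
apply: le_trans (enorm_kronD _ alpha_ge0) _.
by rewrite ler_wpM2l ?vmax_ge0// enorm_y.
Qed.

Let enorm_momentum k :
  enorm (kronD p beta *m (x k - prev_iter x k)) <= bbar * mom k.
Proof. exact: enorm_kronD. Qed.

(** ** The four error recursions *)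

(** [Ainf A = Ainf], so that the projection [1 - Ainf] commutes with the averaging
step, which contracts, and acts on the two perturbations only through its
norm. *)
Lemma consA_step k : consA k.+1 <=
  sigmaA * consA k + cA2 * (opnorm (1%:M - Ainf) *
    (abar * (c2B * consB k + lbar * opnorm Binf * (c2A * consA k + opt k))))
  + cA2 * (opnorm (1%:M - Ainf) * (bbar * mom k)).
Proof.
case: xy => _ xS _; set d := kronD p alpha *m y k.
set e := kronD p beta *m (x k - prev_iter x k).
have -> : x k.+1 - Ainf *m x k.+1 =
    kronI p A *m x k - Ainf *m x k - (1%:M - Ainf) *m d + (1%:M - Ainf) *m e.
  rewrite xS -/d -/e !mulmxDr mulmxN mulmxA Ainf_kronIA !mulmxBl !mul1mx.
  by apply/colP => i; rewrite !mxE; ring.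
apply: le_trans (is_norm_triangle _ _ normA_norm) _; apply: lerD.
  apply: le_trans (is_normB _ _ normA_norm) _; apply: lerD => //.
  apply: le_trans (cA2P _) _; rewrite ler_pM2l//; apply: enormM_le.
  exact: enorm_step.
apply: le_trans (cA2P _) _; rewrite ler_pM2l//; apply: enormM_le.
exact: enorm_momentum.
Qed.

(** [A - 1] vanishes on the range of [Ainf], hence sees only the disagreement. *)
Lemma mom_step k : mom k.+1 <=
  opnorm (kronI p A - 1%:M) * (c2A * consA k)
  + abar * (c2B * consB k + lbar * opnorm Binf * (c2A * consA k + opt k))
  + bbar * mom k.
Proof.
case: xy => _ xS _.
have -> : x k.+1 - prev_iter x k.+1 =
    (kronI p A - 1%:M) *m (x k - Ainf *m x k) - kronD p alpha *m y k
    + kronD p beta *m (x k - prev_iter x k).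
  have AI : (kronI p A - 1%:M) *m (Ainf *m x k) = 0.
    by rewrite mulmxA mulmxBl kronIA_Ainf mul1mx subrr mul0mx.
  rewrite [_ *m (x k - Ainf *m _)]mulmxBr AI subr0 mulmxBl mul1mx /= xS.
  by apply/colP => i; rewrite !mxE; ring.
apply: le_trans (is_norm_triangle _ _ (@enorm_is_norm _ _)) _.
apply: lerD (enorm_momentum k).
apply: le_trans (is_normB _ _ (@enorm_is_norm _ _)) _.
by apply: lerD (enorm_step k); apply: enormM_le.
Qed.

Lemma consB_step k : consB k.+1 <=
  sigmaB * consB k + cB2 * (opnorm (1%:M - Binf) * (lbar * mom k.+1)).
Proof.
case: xy => _ _ yS.
have -> : y k.+1 - Binf *m y k.+1 = kronI p B *m y k - Binf *m y k
    + (1%:M - Binf) *m (grad_stack f (x k.+1) - grad_stack f (x k)).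
  rewrite yS -addrA !mulmxDr !mulmxN mulmxA Binf_kronIB !mulmxBl !mul1mx.
  by apply/colP => i; rewrite !mxE; ring.
apply: le_trans (is_norm_triangle _ _ normB_norm) _; apply: lerD => //.
apply: le_trans (cB2P _) _; rewrite ler_pM2l//; apply: enormM_le.
exact: grad_stack_lip.
Qed.

Let pDp_ge0 : 0 <= pDp.
Proof. by apply: weighted_dot_ge0 => // i; rewrite ltW ?pir_gt0 ?pic_gt0. Qed.

Let pDp_le : pDp <= abar * pp.
Proof. by apply: weighted_dot_le => i; rewrite ltW ?pir_gt0 ?pic_gt0. Qed.

(** The averaged iterate moves by an inexact gradient step of length
[n pDp] on the average objective: the exact step contracts, and the three
remaining terms come from the disagreement of the [x], from the tracking error
of the [y] and from the momentum. *)
Lemma opt_step k : opt k.+1 <=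
  nR * c2A * pp * lbar * abar * consA k
  + Order.max `|1 - mu * nR * pDp| `|1 - l * nR * pDp| * opt k
  + opnorm Ainf * (bbar * mom k) + opnorm Ainf * (abar * (c2B * consB k)).
Proof.
case: xy => _ xS _; set eta := nR * pDp.
pose xh := \sum_j pir j 0 *: block (x k) j.
have AxE : Ainf *m x k = rep n xh.
  by apply: eq_block => i; rewrite block_Ainf block_rep.
pose s := \sum_i (grad (f i) (block (x k) i) - grad (f i) xh).
have Dy : Ainf *m (kronD p alpha *m (Binf *m y k)) =
    rep n (eta *: gradF xh + pDp *: s).
  apply: eq_block => i; rewrite block_Ainf block_rep Binf_tracking.
  transitivity (pDp *: \sum_i grad (f i) (block (x k) i)).
    rewrite weighted_dotE scaler_suml; apply: eq_bigr => j _.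
    rewrite block_kronD block_Binf !scalerA; congr (_ *: _).
    by apply: eq_bigr => j' _; rewrite block_stack.
  rewrite /eta [nR * _]mulrC -scalerA -sum_grad -scalerDr; congr (_ *: _).
  by rewrite /s sumrB addrC subrK.
have -> : Ainf *m x k.+1 - rep n xs =
    rep n (xh - xs - eta *: gradF xh) - rep n (pDp *: s)
    + Ainf *m (kronD p beta *m (x k - prev_iter x k))
    - Ainf *m (kronD p alpha *m (y k - Binf *m y k)).
  rewrite xS !(mulmxDr, mulmxN) [Ainf *m (kronI p A *m _)]mulmxA Ainf_kronIA.
  rewrite AxE Dy.
  apply: eq_block => i; rewrite !(blockB, blockD, blockN) !block_rep.
  by apply/colP => a; rewrite !mxE; ring.
have rep_s : enorm (rep n (pDp *: s)) <= nR * c2A * pp * lbar * abar * consA k.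
  rewrite enorm_rep enormZ (ger0_norm pDp_ge0) mulrCA.
  have sle : Num.sqrt nR * enorm s <= nR * (lbar * (c2A * consA k)).
    apply: le_trans (_ : Num.sqrt nR * (Num.sqrt nR * (lbar * (c2A * consA k))) <= _).
      rewrite ler_wpM2l ?sqrtr_ge0//; apply: le_trans (enorm_sum _ _ _) _.
      have sE i : grad (f i) (block (x k) i) - grad (f i) xh =
          block (grad_stack f (x k) - grad_stack f (Ainf *m x k)) i.
        by rewrite blockB !block_stack AxE block_rep.
      under eq_bigr do rewrite sE.
      apply: le_trans (sum_enorm_block _) _; rewrite ler_wpM2l ?sqrtr_ge0//.
      apply: le_trans (grad_stack_lip _ _) _.
      by rewrite ler_wpM2l ?vmax_ge0.
    by rewrite mulrA -expr2 sqr_sqrtr ?ler0n.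
  have -> : nR * c2A * pp * lbar * abar * consA k =
    abar * pp * (nR * (lbar * (c2A * consA k))) by ring.
  apply: ler_pM => //.
  by rewrite mulr_ge0 ?sqrtr_ge0 ?enorm_ge0.
have rep_x : enorm (rep n (xh - xs - eta *: gradF xh)) <=
    Order.max `|1 - mu * nR * pDp| `|1 - l * nR * pDp| * opt k.
  have -> : opt k = Num.sqrt nR * enorm (xh - xs).
    rewrite AxE -enorm_rep; congr enorm.
    by apply: eq_block => i; rewrite blockB !block_rep.
  rewrite enorm_rep mulrCA ler_wpM2l ?sqrtr_ge0//.
  rewrite -![_ * nR * pDp]mulrA -/eta.
  apply: (gradient_step_contraction average_lower gradF_lip mu_ge0 _ mu_le_l).
    by rewrite mulr_ge0 ?ler0n.
  exact: gradF_xs.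
apply: le_trans (is_normB _ _ (@enorm_is_norm _ _)) _.
apply: lerD; last first.
  apply: enormM_le; apply: le_trans (enorm_kronD _ alpha_ge0) _.
  by rewrite ler_wpM2l ?vmax_ge0.
apply: le_trans (is_norm_triangle _ _ (@enorm_is_norm _ _)) _.
apply: lerD; last by apply: enormM_le; exact: enorm_momentum.
apply: le_trans (is_normB _ _ (@enorm_is_norm _ _)) _.
by rewrite addrC; exact: lerD.
Qed.

End OneStep.

(** * The error recursion as a linear system *)

(** An infinite quotient, with [y = 0], exceeds [b] only if [x] is positive, so
the conclusion does not depend on whether [y] vanishes. *)
Lemma lt_equot (R : realType) (b x y : R) :
  0 <= b -> 0 <= y -> (b%:E < equot x y)%E -> b * y < x.
Proof.
move=> b0; rewrite le_eqVlt /equot inver => /orP[/eqP <-|y0]; last first.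
  by rewrite gt_eqF// -EFinM lte_fin ltr_pdivlMr.
rewrite eqxx mulr0; have [x0|//|->] := ltgtP x 0.
  by rewrite lt0_muley ?lte_fin.
by rewrite mul0e lte_fin ltNge b0.
Qed.

Lemma mulmx_rowsE (R : realType) m n (rows : seq (seq R)) (s : seq R) i :
  (mx_of_rows m n rows *m col_of_seq n s) i 0 =
    \sum_(j < n) (nth [::] rows i)`_j * s`_j.
Proof. by rewrite mxE; apply: eq_bigr => j _; rewrite !mxE. Qed.

Lemma le_of_eq (R : numDomainType) (a b : R) : a = b -> a <= b.
Proof. by move=> ->. Qed.

Theorem theorem1 (R : realType) (n p : nat) (p_gt0 : (0 < p)%N)
  (* network and weights *)
  (E : rel 'I_n) (E_sc : strongly_connected E)
  (A B : 'M[R]_n)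
  (A_row : row_stochastic_weights E A)
  (B_col : column_stochastic_weights E B)
  (pir pic : 'cV[R]_n)
  (pirA : pir^T *m A = pir^T) (pir1 : (pir^T *m ones) 0 0 = 1)
  (Bpic : B *m pic = pic) (pic1 : ((ones : 'cV[R]_n)^T *m pic) 0 0 = 1)
  (* objectives *)
  (f : 'I_n -> 'cV[R]_p -> R) (mus ls : 'cV[R]_n)
  (f_diff : forall i x, differentiable (f i) x)
  (mus_ge0 : forall i, 0 <= mus i 0) (mus_gt0 : 0 < \sum_(i < n) mus i 0)
  (f_sc : forall i, strongly_convex (mus i 0) (f i))
  (ls_gt0 : forall i, 0 < ls i 0)
  (f_smooth : forall i, smooth (ls i 0) (f i))
  (xs : 'cV[R]_p) (xs_min : unique_minimizer (average f) xs)
  (* step-sizes, momentum parameters and iterates *)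
  (alpha beta : 'cV[R]_n)
  (alpha_ge0 : forall i, 0 <= alpha i 0) (beta_ge0 : forall i, 0 <= beta i 0)
  (x y : nat -> 'cV[R]_(n * p)) (xy : ABm A B alpha beta f x y)
  (* norms *)
  (normA normB : 'cV[R]_(n * p) -> R)
  (normA_norm : is_norm normA) (normB_norm : is_norm normB)
  (sigmaA sigmaB : R)
  (sigmaA01 : 0 < sigmaA < 1) (sigmaB01 : 0 < sigmaB < 1)
  (contrA : forall v,
     normA (kronI p A *m v - lim_pow (kronI p A) *m v)
       <= sigmaA * normA (v - lim_pow (kronI p A) *m v))
  (contrB : forall v,
     normB (kronI p B *m v - lim_pow (kronI p B) *m v)
       <= sigmaB * normB (v - lim_pow (kronI p B) *m v))
  (c2A cA2 c2B cB2 : R)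
  (c2A_gt0 : 0 < c2A) (cA2_gt0 : 0 < cA2)
  (c2B_gt0 : 0 < c2B) (cB2_gt0 : 0 < cB2)
  (c2AP : forall v, enorm v <= c2A * normA v)
  (cA2P : forall v, normA v <= cA2 * enorm v)
  (c2BP : forall v, enorm v <= c2B * normB v)
  (cB2P : forall v, normB v <= cB2 * enorm v) :
  let nR : R := n%:R in
  let mu := nR^-1 * \sum_(i < n) mus i 0 in
  let l := nR^-1 * \sum_(i < n) ls i 0 in
  let lbar := vmax ls in
  let abar := vmax alpha in
  let bbar := vmax beta in
  let Ainf := lim_pow (kronI p A) in
  let Binf := lim_pow (kronI p B) in
  let I : 'M[R]_(n * p) := 1%:M in
  let pDp := (pir^T *m diag_mx alpha^T *m pic) 0 0 in
  let pp := (pir^T *m pic) 0 0 in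
  let a1 := cA2 * c2A * lbar * opnorm (I - Ainf) * opnorm Binf in
  let a2 := cA2 * lbar * opnorm (I - Ainf) * opnorm Binf in
  let a3 := cA2 * opnorm (I - Ainf) in
  let a4 := cA2 * c2B * opnorm (I - Ainf) in
  let a5 := nR * c2A * pp * lbar in
  let a6 := opnorm Ainf in
  let a7 := c2B * opnorm Ainf in
  let a8 := c2A * opnorm (kronI p A - I) in
  let a9 := c2A * lbar * opnorm Binf in
  let a10 := lbar * opnorm Binf in
  let a11 := c2B in
  let a12 := cB2 * c2A * lbar * opnorm (I - Binf) * opnorm (kronI p A - I) in
  let a13 := cB2 * c2A * lbar ^+ 2 * opnorm (I - Binf) * opnorm Binf in
  let a14 := cB2 * lbar ^+ 2 * opnorm (I - Binf) * opnorm Binf in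
  let a15 := cB2 * lbar * opnorm (I - Binf) in
  let a16 := cB2 * c2B * lbar * opnorm (I - Binf) in
  let lambda : R := Order.max `|1 - mu * nR * pDp| `|1 - l * nR * pDp| in
  let J : 'M[R]_4 := mx_of_rows 4 4
    [:: [:: sigmaA + a1 * abar; a2 * abar;  bbar * a3;  a4 * abar];
        [:: a5 * abar;          lambda;     bbar * a6;  a7 * abar];
        [:: a8 + a9 * abar;     a10 * abar; bbar;       a11 * abar];
        [:: a12 + a13 * abar;   a14 * abar; bbar * a15; sigmaB + a16 * abar]] in
  let t (k : nat) : 'cV[R]_4 := col_of_seq 4
    [:: normA (x k - Ainf *m x k);
        enorm (Ainf *m x k - rep n xs);
        enorm (x k - prev_iter x k);
        normB (y k - Binf *m y k)] in
  0 < pDp < 2 / (nR * l) ->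
  (forall (k : nat) (i : 'I_4), t k.+1 i 0 <= (J *m t k) i 0) /\
  (forall delta1 delta2 delta3 delta4 : R,
     0 < delta1 ->
     (delta1%:E < Order.min (equot delta3 a8)
                            (equot ((1 - sigmaB) * delta4) a12))%E ->
     (a5 * delta1 + a7 * delta4) / (mu * vmin pir * vmin pic) < delta2 ->
     0 < delta3 ->
     0 < delta4 ->
     0 < abar ->
     (abar%:E <
        Order.min (equot 1 (nR * l * pp))
       (Order.min (equot (delta1 * (1 - sigmaA))
                         (a1 * delta1 + a2 * delta2 + a4 * delta4))
       (Order.min (equot (delta3 - delta1 * a8)
                         (a9 * delta1 + a10 * delta2 + a11 * delta4))
                  (equot ((1 - sigmaB) * delta4 - delta1 * a12)
                         (a13 * delta1 + a14 * delta2 + a16 * delta4)))))%E ->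
     0 <= bbar ->
     (bbar%:E <
        Order.min (equot (delta1 * (1 - sigmaA)
                          - (a1 * delta1 + a2 * delta2 + a4 * delta4) * abar)
                         (a3 * delta3))
       (Order.min (equot ((delta2 * mu * vmin pir * vmin pic
                           - (a5 * delta1 + a7 * delta4)) * abar)
                         (a6 * delta3))
       (Order.min (equot (delta3 - delta1 * a8
                          - (a9 * delta1 + a10 * delta2 + a11 * delta4) * abar)
                         delta3)
                  (equot ((1 - sigmaB) * delta4 - delta1 * a12
                          - (a13 * delta1 + a14 * delta2 + a16 * delta4) * abar)
                         (a15 * delta3)))))%E ->
     [/\ spectral_radius J < 1,
         enorm (x k - rep n xs) @[k --> \oo] --> (0 : R)
       & exists C : R, forall k : nat,
           enorm (x k - rep n xs) <= C * spectral_radius J ^+ k]).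
Proof.
move=> nR mu l lbar abar bbar Ainf Binf I pDp pp.
have [sA0 sA1] := andP sigmaA01; have [sB0 sB1] := andP sigmaB01.
have n0 := n_gt0 pir1.
have pir0 := pir_gt0 p_gt0 E_sc A_row pirA pir1 normA_norm sA1 contrA.
have pic0 := pic_gt0 p_gt0 E_sc B_col pir1 Bpic pic1 normB_norm sB1 contrB.
have AE : Ainf = _ := AinfE p_gt0 E_sc A_row pirA pir1 normA_norm sA1 contrA.
have BE : Binf = _ := BinfE p_gt0 E_sc B_col pir1 Bpic pic1 normB_norm sB1 contrB.
have sA := consA_step p_gt0 E_sc A_row B_col pir1 Bpic pic1 mus_ge0 f_sc ls_gt0
  f_smooth xs_min alpha_ge0 beta_ge0 xy normA_norm normB_norm sA1 sB1 contrA
  contrB cA2_gt0 c2AP cA2P c2BP.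
have sO := opt_step p_gt0 E_sc A_row B_col pirA pir1 Bpic pic1 mus_ge0 f_sc ls_gt0
  f_smooth xs_min alpha_ge0 beta_ge0 xy normA_norm normB_norm sA1 sB1 contrA
  contrB c2AP c2BP.
have sM := mom_step p_gt0 E_sc A_row B_col pir1 Bpic pic1 mus_ge0 f_sc ls_gt0
  f_smooth xs_min alpha_ge0 beta_ge0 xy normA_norm normB_norm sA1 sB1 contrA
  contrB c2AP c2BP.
have sB := consB_step p_gt0 pir1 Bpic pic1 f_smooth xy normB_norm sB1 contrB
  cB2_gt0 cB2P.
have dist := enorm_sub_opt A xs x c2AP.
rewrite -/Ainf -/Binf -/I -/lbar -/abar -/bbar in sA.
rewrite -/Ainf -/nR -/pp -/pDp -/mu -/l -/lbar -/abar -/bbar in sO.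
rewrite -/Ainf -/Binf -/I -/lbar -/abar -/bbar in sM.
rewrite -/Binf -/I -/lbar in sB.
rewrite -/Ainf in dist.
have lbar0 : 0 < lbar by apply: lt_le_trans (le_vmax ls (Ordinal n0)).
have oA0 : 0 < opnorm Ainf.
  by rewrite AE opnorm_gt0// kronI_outer_neq0// => i; rewrite mxE.
have oB0 : 0 < opnorm Binf.
  by rewrite BE opnorm_gt0// kronI_outer_neq0// => i; rewrite mxE.
have oAI0 : 0 <= opnorm (kronI p A - I) := opnorm_ge0 _.
(* A single agent agrees with itself: both projections are the identity. *)
have single_or_network :
    (0 < opnorm (I - Ainf) /\ 0 < opnorm (I - Binf)) \/
    [/\ opnorm (I - Ainf) = 0, opnorm (I - Binf) = 0,
       forall k, normA (x k - Ainf *m x k) = 0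
     & forall k, normB (y k - Binf *m y k) = 0].
  have [n1|n1] := ltnP 1 n.
    left; rewrite AE BE; split; apply: opnorm_gt0; apply: kronI_outer_neq1 => //;
    by move=> i; rewrite mxE.
  have A1 : Ainf = 1%:M by rewrite AE kronI_outer_eq1.
  have B1 : Binf = 1%:M by rewrite BE kronI_outer_eq1.
  right; rewrite A1 B1 /I subrr opnorm0; split => // k.
    by rewrite mul1mx subrr is_norm0.
  by rewrite mul1mx subrr is_norm0.
have nR1 : 1 <= nR by rewrite ler1n.
have mu_gt0 : 0 < mu by rewrite mulr_gt0// invr_gt0 ltr0n.
have l_gt0 : 0 < l := l_gt0 pir1 ls_gt0.
have mul : mu <= l := mu_le_l p_gt0 mus_ge0 f_sc f_smooth.
have pp_gt0 : 0 < pp.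
  rewrite /pp mxE (bigD1 (Ordinal n0))//= ltr_wpDr//.
    by apply: sumr_ge0 => i _; rewrite mxE mulr_ge0// ltW.
  by rewrite mxE mulr_gt0.
have pDp0 : 0 <= pDp by apply: weighted_dot_ge0 => // i; rewrite ltW.
have pDp_hi : pDp <= abar * pp by apply: weighted_dot_le => i; rewrite ltW.
have pDp_lo : vmin pir * vmin pic * abar <= pDp := weighted_dot_ge pir0 alpha_ge0 pic0.
(* From here on the operator norms and the smallest entries are arbitrary
numbers, constrained only by the facts above. *)
have := vmin_gt0 n0 pir0; have := vmin_gt0 n0 pic0; move: pDp_lo.
move: (vmin pir) (vmin pic) => vr vc pDp_lo vc_gt0 vr_gt0.
move: (opnorm (I - Ainf)) (opnorm (I - Binf)) (opnorm (kronI p A - I))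
  (opnorm Ainf) (opnorm Binf) => oIA oIB oAI oA oB
  in sA sO sM sB oA0 oB0 oAI0 single_or_network *.
clear AE BE pir0 pic0 mus_gt0 mus_ge0 f_sc ls_gt0 f_smooth alpha_ge0 beta_ge0.
clearbody nR mu l lbar abar bbar pDp pp.
move=> a1 a2 a3 a4 a5 a6 a7 a8 a9 a10 a11 a12 a13 a14 a15 a16.
move=> lambda J t pDp_bounds.
have recursion k i : t k.+1 i 0 <= (J *m t k) i 0.
  rewrite mulmx_rowsE !big_ord_recr big_ord0 /= mxE.
  case: i => [[|[|[|[|//]]]] ?] /=.
  - by apply: (le_trans (sA k)); apply: le_of_eq; rewrite /a1 /a2 /a3 /a4; ring.
  - apply: (le_trans (sO k)); apply: le_of_eq; rewrite /a5 /a6 /a7 /lambda; ring.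
  - by apply: (le_trans (sM k)); apply: le_of_eq; rewrite /a8 /a9 /a10 /a11; ring.
  - apply: (le_trans (sB k)).
    apply: le_trans (lerD (lexx _) (ler_wpM2l (ltW cB2_gt0) (ler_wpM2l _
      (ler_wpM2l (ltW lbar0) (sM k))))) _.
      by case: single_or_network => [[_ /ltW]|[_ ->]].
    apply: le_of_eq; rewrite /a12 /a13 /a14 /a15 /a16; ring.
split => // d1 d2 d3 d4 d1_gt0 _ d2_lb d3_gt0 d4_gt0 ab0 ab_lt bb0 bb_lt.
have [oIA0 oIB0] : 0 <= oIA /\ 0 <= oIB.
  by case: single_or_network => [[/ltW ? /ltW]|[-> ->]].
have oA0' := ltW oA0; have oB0' := ltW oB0.
have [c2A0 cA20 c2B0 cB20] := And4 (ltW c2A_gt0) (ltW cA2_gt0) (ltW c2B_gt0) (ltW cB2_gt0).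
have [sA0' sB0' lb0] := And3 (ltW sA0) (ltW sB0) (ltW lbar0).
have nR0 : 0 <= nR by exact: le_trans nR1.
have pp0 := ltW pp_gt0.
have a1_0 : 0 <= a1 by rewrite !mulr_ge0.
have a2_0 : 0 <= a2 by rewrite !mulr_ge0.
have a3_0 : 0 <= a3 by rewrite !mulr_ge0.
have a4_0 : 0 <= a4 by rewrite !mulr_ge0.
have a5_0 : 0 < a5 by rewrite !mulr_gt0 // (lt_le_trans _ nR1).
have a6_0 : 0 < a6 by [].
have a7_0 : 0 < a7 by rewrite !mulr_gt0.
have a8_0 : 0 <= a8 by rewrite !mulr_ge0.
have a9_0 : 0 < a9 by rewrite !mulr_gt0.
have a10_0 : 0 < a10 by rewrite !mulr_gt0.
have a11_0 : 0 < a11 by [].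
have a12_0 : 0 <= a12 by rewrite !mulr_ge0.
have a13_0 : 0 <= a13 by rewrite !mulr_ge0 ?exprn_ge0.
have a14_0 : 0 <= a14 by rewrite !mulr_ge0 ?exprn_ge0.
have a15_0 : 0 <= a15 by rewrite !mulr_ge0.
have a16_0 : 0 <= a16 by rewrite !mulr_ge0.
have a_cases : [/\ 0 < a2, 0 < a3, 0 < a4 & 0 < a14] /\ 0 < a13 /\ 0 < a15 \/
   [/\ a2 = 0, a3 = 0, a14 = 0, a15 = 0 & forall k, t k 0 0 = 0 /\ t k 3 0 = 0].
  case: single_or_network => [[IA IB]|[IA IB A0 B0]].
    by left; split; [|split]; [split| |]; rewrite !mulr_gt0 ?exprn_gt0.
  right; split; rewrite ?/a2 ?/a3 ?/a14 ?/a15 ?IA ?IB ?(mulr0, mul0r)//.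
  by move=> k; rewrite !mxE /= A0 B0.
clearbody a1 a2 a3 a4 a5 a6 a7 a8 a9 a10 a11 a12 a13 a14 a15 a16.
clear sA sO sM sB single_or_network.
have ab0' := ltW ab0.
have d2_gt0 : 0 < d2.
  apply: le_lt_trans d2_lb; apply: divr_ge0.
    by rewrite addr_ge0// mulr_ge0// ltW.
  by rewrite !mulr_ge0// ltW.
have [d10 d20 d30 d40] := And4 (ltW d1_gt0) (ltW d2_gt0) (ltW d3_gt0) (ltW d4_gt0).
have lam_lt1 : l * nR * pDp < 1.
  have : abar * (nR * l * pp) < 1.
    apply: lt_equot => //; first by rewrite !mulr_ge0// ltW.
    by move: ab_lt; rewrite lt_min => /andP[].
  apply: le_lt_trans; have -> : abar * (nR * l * pp) = l * nR * (abar * pp) by ring.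
  by rewrite ler_wpM2l// mulr_ge0// ltW.
(* [l eta < 1] and [mu <= l], so the maximum is attained at [1 - mu eta]. *)
have [lam_gt0 lam_le] : 0 < lambda /\ lambda <= 1 - mu * nR * pDp.
  have h1 : mu * nR * pDp <= l * nR * pDp by rewrite ler_wpM2r// ler_wpM2r.
  rewrite /lambda; move: (mu * nR * pDp) (l * nR * pDp) h1 lam_lt1 => u v uv v1.
  have [u1 v1'] : 0 <= 1 - u /\ 0 < 1 - v by clear -uv v1; split; lra.
  rewrite !ger0_norm ?(ltW v1')// lt_max v1' orbT ge_max lexx.
  by rewrite lerD2l lerN2.
have step_lo : mu * vr * vc * abar <= mu * nR * pDp.
  apply: le_trans (_ : mu * (1 * pDp) <= _).
    by rewrite mul1r -!mulrA ler_pM2l// mulrA.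
  by rewrite -mulrA ler_pM2l// ler_wpM2r.
clearbody lambda.
move: bb_lt; rewrite !lt_min => /andP[/lt_equot b1 /andP[/lt_equot b2]].
move=> /andP[/lt_equot b3 /lt_equot b4].
have {}b1 := b1 bb0 (mulr_ge0 a3_0 d30).
have {}b2 := b2 bb0 (mulr_ge0 (ltW a6_0) d30).
have {}b3 := b3 bb0 d30; have {}b4 := b4 bb0 (mulr_ge0 a15_0 d30).
have J0 i j : 0 <= J i j.
  rewrite mxE; case: i => [[|[|[|[|//]]]] ?]; case: j => [[|[|[|[|//]]]] ?] /=;
  by rewrite ?addr_ge0 ?mulr_ge0// ltW.
pose d : 'cV[R]_4 := col_of_seq 4 [:: d1; d2; d3; d4].
have d0 i : 0 < d i 0 by rewrite mxE; case: i => [[|[|[|[|//]]]] ?] /=.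
have Jd i : (J *m d) i 0 < d i 0.
  rewrite mulmx_rowsE !big_ord_recr big_ord0 /= mxE.
  case: i => [[|[|[|[|//]]]] ?] /=.
  - by move: b1; clear; lra.
  - have : lambda * d2 <= (1 - mu * vr * vc * abar) * d2.
      by rewrite ler_wpM2r// (le_trans lam_le)// lerD2l lerN2.
    by move: b2; clear; lra.
  - by move: b3; clear; lra.
  - by move: b4; clear; lra.
have rho1 := spectral_radius_lt1 J0 d0 Jd.
have rhoP := eigenvalue_le_spectral_radius J0 d0 Jd.
clear b1 b2 b3 b4 d2_lb ab_lt d d0 Jd.
(* Only the first two errors enter the distance to the minimizer. *)
have [r [C [r0 C0 rJ tC]]] : exists r C, [/\ 0 <= r, 0 <= C,
    eigenvalue (map_mx (real_complex R) J) r%:C%C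
  & forall k, t k 0 0 <= C * r ^+ k /\ t k 1 0 <= C * r ^+ k].
  case: a_cases => [[[a20 a30 a40 a140] [a130 a150]]|[a20 a30 a140 a150 t0]].
    (* The third column is a multiple of [bbar]. *)
    have Jpos (i j : 'I_4) : (j != 2%N :> nat) || (0 < bbar) -> 0 < J i j.
      rewrite mxE; case: i => [[|[|[|[|//]]]] ?]; case: j => [[|[|[|[|//]]]] ?] /= bb;
      first [by rewrite ?mulr_gt0 | by rewrite ltr_wpDr ?mulr_ge0 ?mulr_gt0
            | by rewrite ltr_wpDl ?mulr_gt0].
    have Jcol j : (forall i, 0 < J i j) \/ (forall i, J i j = 0).
      have [jb|] := boolP ((j != 2%N :> nat) || (0 < bbar)).
        by left=> i; exact: Jpos.
      rewrite negb_or negbK -leNgt => /andP[/eqP j2 bb]; right=> i.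
      have bbar0 : bbar = 0 by apply/eqP; rewrite eq_le bb.
      rewrite mxE j2 bbar0.
      by case: i => [[|[|[|[|//]]]] ?] /=; rewrite ?mul0r.
    have J00 i : 0 < J i 0 by exact: Jpos.
    have [r [w [r0 w0 Jw]]] := perron J0 Jcol J00.
    have [C C0 tC] := geometric_bound J0 w0 Jw recursion.
    exists r, (C * (w 0 0 + w 1 0)); split.
    - exact: ltW.
    - by rewrite mulr_ge0// addr_ge0// ltW.
    - apply: (right_eigenvalue _ Jw); apply/eqP => /colP/(_ 0) /eqP.
      by rewrite [X in _ == X]mxE gt_eqF.
    - move=> k; rewrite mulrAC; split; apply: (le_trans (tC k _));
      by rewrite ler_wpM2l ?mulr_ge0 ?exprn_ge0 ?(ltW r0)// ?lerDl ?lerDr ltW.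
  (* A single agent: rows and columns 0 and 3 of [J] concern errors that are
  zero, and the remaining block [P] governs the other two. *)
  have c0 : 0 < a10 * abar by rewrite mulr_gt0.
  pose P : 'M[R]_2 := mx_of_rows 2 2
    [:: [:: lambda; bbar * a6]; [:: a10 * abar; bbar]].
  have P0 i j : 0 <= P i j.
    rewrite mxE; case: i => [[|[|//]] ?]; case: j => [[|[|//]] ?] /=;
    by rewrite ?mulr_ge0// ltW.
  have P00 i : 0 < P i 0 by rewrite mxE; case: i => [[|[|//]] ?] /=.
  have Pcol j : (forall i, 0 < P i j) \/ (forall i, P i j = 0).
    case: j => [[|[|//]] ?].
      by left=> i; rewrite mxE; case: i => [[|[|//]] ?] /=.
    have [bb|bb] := eqVneq bbar 0.
      by right=> i; rewrite mxE bb; case: i => [[|[|//]] ?] /=; rewrite ?mul0r.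
    have bb_gt0 : 0 < bbar by rewrite lt_neqAle eq_sym bb.
    by left=> i; rewrite mxE; case: i => [[|[|//]] ?] /=; rewrite ?mulr_gt0.
  have [r [w [r0 w0 Pw]]] := perron P0 Pcol P00.
  pose s k : 'cV[R]_2 := col_of_seq 2 [:: t k 1 0; t k 2 0].
  have sP k i : s k.+1 i 0 <= (P *m s k) i 0.
    have rec (j : 'I_4) := recursion k j; have [z0 z3] := t0 k.
    rewrite mulmx_rowsE !big_ord_recr big_ord0 /= [X in X <= _]mxE.
    rewrite !mxE /= in z0 z3 *.
    case: i => [[|[|//]] ?] /=; [have := rec 1|have := rec 2];
    rewrite mulmx_rowsE !big_ord_recr big_ord0 /= z0 z3 mxE /= ?a140;
    by rewrite !mulr0 !(addr0, add0r).
  have [C C0 sC] := geometric_bound P0 w0 Pw sP.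
  exists r, (C * w 0 0); split.
  - exact: ltW.
  - by rewrite mulr_ge0// ltW.
  - have wE : w = col_of_seq 2 [:: w 0 0; w 1 0].
      apply/colP => i; rewrite mxE; case: i => [[|[|//]] ?] /=; congr (w _ _);
      exact: val_inj.
    pose v : 'cV[R]_4 := col_of_seq 4 [:: 0; w 0 0; w 1 0; 0].
    have Jv : J *m v = r *: v.
      have e i : (P *m w) i 0 = r * w i 0 by rewrite Pw mxE.
      have := e 1; have := e 0; rewrite {1 3}wE !mulmx_rowsE !big_ord_recr !big_ord0 /=.
      rewrite !add0r => e0 e1.
      apply/colP => i; rewrite mulmx_rowsE !big_ord_recr big_ord0 /= !mxE.
      case: i => [[|[|[|[|//]]]] ?] /=; rewrite ?a20 ?a30 ?a140 ?a150;
      rewrite !(mul0r, mulr0, add0r, addr0)//.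
    apply: (right_eigenvalue _ Jv); apply/eqP => /colP/(_ 1) /eqP.
    by rewrite !mxE /= gt_eqF.
  - move=> k; have := sC k 0; rewrite mxE /= => h; split; last by rewrite mulrAC.
    by rewrite (t0 k).1 !mulr_ge0 ?exprn_ge0// ltW.
have rho0 : 0 <= spectral_radius J := le_trans r0 (rhoP r r0 rJ).
(* [r] is an eigenvalue of [J], hence at most its spectral radius. *)
have bound k : enorm (x k - rep n xs) <= (c2A + 1) * C * spectral_radius J ^+ k.
  apply: (le_trans (dist k)); have [h0 h1] := tC k; rewrite !mxE /= in h0 h1.
  apply: le_trans (_ : c2A * (C * r ^+ k) + C * r ^+ k <= _).
    by rewrite lerD// ler_wpM2l.
  rewrite -[X in _ + X]mul1r -mulrDl -mulrA ler_wpM2l ?addr_ge0//.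
  by rewrite ler_wpM2l// lerXn2r ?nnegrE// rhoP.
split => //; last by eexists; exact: bound.
apply: (@squeeze_cvgr _ _ _ _ (fun=> 0) (fun k => (c2A + 1) * C * spectral_radius J ^+ k)).
- by apply: nearW => k; rewrite enorm_ge0 bound.
- exact: cvg_cst.
- rewrite -[X in _ --> X](mulr0 ((c2A + 1) * C)); apply: cvgMr.
  by apply: cvg_expr; rewrite ger0_norm.
Qed.
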